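(* Let $k$ be a field and let $1\to B\xrightarrow{\iota}A\xrightarrow{\pi}H\to 1$ be a central exact sequence of Hopf algebras over $k$ with $A$ noetherian. For $i=1,2$ let $p_i:B\to K_i$ be a surjective Hopf algebra map, $J_i=\operatorname{Ker}p_i$, $A_i:=A/AJ_i$ with quotient map $q_i:A\to A_i$, and $j_i:K_i\to A_i$ the induced map (so that $A_i$ is the pushout of $\iota$ and $p_i$, and $1\to K_i\xrightarrow{j_i}A_i\xrightarrow{\pi_i}H\to1$ is a central exact sequence, where $\pi_i$ is induced by $\pi$). Assume: (L) every Hopf algebra automorphism $f$ of $H$ lifts to a Hopf algebra automorphism $F$ of $A$ with $\pi F=f\pi$; and (Z) $\mathcal{HZ}(H)=k$. Then $A_1$ and $A_2$ are isomorphic as Hopf algebras if and only if there exist (a) a Hopf algebra isomorphism $\underline{\omega}:K_1\to K_2$, (b) an element $g\in\operatorname{qAut}(B)$, together with a Hopf algebra automorphism $F$ of $A$ satisfying $F\iota=\iota g$ and $\pi F=\overline{\omega}\pi$ for some Hopf algebra automorphism $\overline{\omega}$ of $H$, (c) an algebra map $u:A\to K_2$ such that for all $b\in B$ and $a\in A$ $$\underline{\omega}(p_1(b))=p_2(g(b_{(1)}))\,u(\iota(b_{(2)})),$$ $$\Delta(u(a))=u(a_{(2)})\otimes q_2\big(F(\mathcal S(a_{(1)})a_{(3)})\big)\,u(a_{(4)}).$$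
   Context: All Hopf algebras have bijective antipode $\mathcal S$; Sweedler notation is used for comultiplication. A sequence of Hopf algebra maps $1\to B\xrightarrow{\iota}A\xrightarrow{\pi}H\to1$ is exact if $\iota$ is injective, $\pi$ is surjective, $\operatorname{Ker}\pi=AB^+$ (where $B^+=\operatorname{Ker}\varepsilon$) and $B={}^{\mathrm{co}\,\pi}A=\{a\in A:(\pi\otimes\mathrm{id})\Delta(a)=1\otimes a\}$; it is central if $\iota(B)$ is central in $A$. The Hopf center $\mathcal{HZ}(A)$ of a Hopf algebra $A$ is its maximal central Hopf subalgebra. Under (L) and (Z) one has $B=\mathcal{HZ}(A)$, so for every lift $F$ as in (L), $F|_B$ is a Hopf automorphism of $B$; $\operatorname{qAut}(B)$ denotes the subgroup of the group of Hopf algebra automorphisms of $B$ generated by all such restrictions $F|_B$. *)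

(* Defs.v *)
(* Hopf algebras over a field k are set up from scratch:
   MathComp has no tensor products of (possibly infinite-dimensional)
   vector spaces, so an element of U (x) V is represented by a finite list
   of pairs (Sweedler-style sum) and two such lists are identified when all
   products of linear functionals agree on them (over a field, pairs of
   linear functionals separate the points of U (x) V). *)
From HB Require Import structures.
From mathcomp Require Import all_boot all_order all_algebra.
Set Implicit Arguments. Unset Strict Implicit. Unset Printing Implicit Defensive.
Import Order.TTheory GRing.Theory Num.Theory.
Local Open Scope ring_scope.

Definition surjective (X Y : Type) (f : X -> Y) : Prop := forall y, exists x, f x = y.

Section Tensors.
Variable k : fieldType.

Definition lin_fun (U : lmodType k) (f : U -> k) : Prop :=
  forall (c : k) (x y : U), f (c *: x + y) = c * f x + f y.

Definition teq (U V : lmodType k) (s t : seq (U * V)) : Prop :=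
  forall (f : U -> k) (g : V -> k), lin_fun f -> lin_fun g ->
    \sum_(p <- s) f p.1 * g p.2 = \sum_(p <- t) f p.1 * g p.2.

Definition teq3 (U V W : lmodType k) (s t : seq (U * V * W)) : Prop :=
  forall (f : U -> k) (g : V -> k) (h : W -> k),
    lin_fun f -> lin_fun g -> lin_fun h ->
    \sum_(p <- s) f p.1.1 * g p.1.2 * h p.2
    = \sum_(p <- t) f p.1.1 * g p.1.2 * h p.2.

Definition tscale (U V : lmodType k) (c : k) (s : seq (U * V)) :=
  [seq (c *: p.1, p.2) | p <- s].

Definition tmul (A : algType k) (s t : seq (A * A)) : seq (A * A) :=
  flatten [seq [seq (p.1 * q.1, p.2 * q.2) | q <- t] | p <- s].

Definition klinear (U V : lmodType k) (f : U -> V) : Prop :=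
  forall (c : k) (x y : U), f (c *: x + y) = c *: f x + f y.

Definition alg_map (A B : algType k) (f : A -> B) : Prop :=
  [/\ klinear f, forall x y, f (x * y) = f x * f y & f 1 = 1].

Record hopf_axioms (A : algType k) (cm : A -> seq (A * A)) (cu : A -> k)
    (ap : A -> A) : Prop := HopfAxioms {
  cm_lin : forall c x y, teq (cm (c *: x + y)) (tscale c (cm x) ++ cm y);
  cm_mul : forall x y, teq (cm (x * y)) (tmul (cm x) (cm y));
  cm_one : teq (cm 1) [:: (1, 1)];
  cm_coassoc : forall x,
    teq3 (flatten [seq [seq (p.1, q.1, q.2) | q <- cm p.2] | p <- cm x])
         (flatten [seq [seq (q.1, q.2, p.2) | q <- cm p.1] | p <- cm x]);
  cu_lin : lin_fun cu;
  cu_mul : forall x y, cu (x * y) = cu x * cu y;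
  cu_one : cu 1 = 1;
  counit_l : forall x, \sum_(p <- cm x) cu p.1 *: p.2 = x;
  counit_r : forall x, \sum_(p <- cm x) cu p.2 *: p.1 = x;
  ap_lin : klinear ap;
  antipode_l : forall x, \sum_(p <- cm x) ap p.1 * p.2 = (cu x)%:A;
  antipode_r : forall x, \sum_(p <- cm x) p.1 * ap p.2 = (cu x)%:A;
  ap_bij : bijective ap
}.

End Tensors.

Record hopf (k : fieldType) := Hopf {
  hcar :> algType k;
  cm : hcar -> seq (hcar * hcar);
  cu : hcar -> k;
  ap : hcar -> hcar;
  hopfP : hopf_axioms cm cu ap
}.
Arguments cm {k} h _.
Arguments cu {k} h _.
Arguments ap {k} h _.

Section HopfNotions.
Variable k : fieldType.

Definition hopf_map (A B : hopf k) (f : A -> B) : Prop :=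
  [/\ alg_map f,
      forall x, teq (cm B (f x)) [seq (f p.1, f p.2) | p <- cm A x]
    & forall x, cu B (f x) = cu A x].

Definition hopf_iso (A B : hopf k) (f : A -> B) : Prop :=
  hopf_map f /\ bijective f.

Definition hopf_auto (A : hopf k) (f : A -> A) : Prop := hopf_iso f.

Definition cm3 (A : hopf k) (a : A) : seq (A * A * A * A) :=
  flatten [seq flatten [seq [seq (p.1, q.1, r.1, r.2) | r <- cm A q.2]
                       | q <- cm A p.2] | p <- cm A a].

Definition central_exact (B A H : hopf k) (i : B -> A) (pi : A -> H) : Prop :=
  [/\ hopf_map i /\ hopf_map pi, injective i /\ surjective pi,
      (forall a : A, pi a = 0 <->
         exists s : seq (A * B), all (fun p => cu B p.2 == 0) s /\
                                 a = \sum_(p <- s) p.1 * i p.2),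
      (forall a : A, (exists b, a = i b) <->
         teq [seq (pi p.1, p.2) | p <- cm A a] [:: (1, a)])
    &
      (forall (b : B) (a : A), i b * a = a * i b)].

Definition left_ideal (A : algType k) (I : A -> Prop) : Prop :=
  [/\ I 0, forall x y, I x -> I y -> I (x + y) & forall a x, I x -> I (a * x)].
Definition right_ideal (A : algType k) (I : A -> Prop) : Prop :=
  [/\ I 0, forall x y, I x -> I y -> I (x + y) & forall a x, I x -> I (x * a)].

Definition acc_on (A : Type) (C : (A -> Prop) -> Prop) : Prop :=
  forall I : nat -> A -> Prop, (forall n, C (I n)) ->
    (forall n x, I n x -> I n.+1 x) ->
    exists n, forall m, (n <= m)%N -> forall x, I m x <-> I n x.

Definition noetherian (A : algType k) : Prop :=
  acc_on (@left_ideal A) /\ acc_on (@right_ideal A).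

Definition hopf_subalg (H : hopf k) (S : H -> Prop) : Prop :=
  [/\ S 1, (forall x y, S x -> S y -> S (x + y)) /\
      (forall (c : k) x, S x -> S (c *: x)),
      forall x y, S x -> S y -> S (x * y),
      forall x, S x -> S (ap H x)
    & forall x, S x -> exists s : seq (H * H),
        (forall p, p \in s -> S p.1 /\ S p.2) /\ teq s (cm H x)].

Definition hopf_center_trivial (H : hopf k) : Prop :=
  forall S : H -> Prop, hopf_subalg S -> (forall x y, S x -> x * y = y * x) ->
    forall x, S x -> exists c : k, x = c%:A.

Inductive gen_grp (B : Type) (gens : (B -> B) -> Prop) : (B -> B) -> Prop :=
| gen_base g : gens g -> gen_grp gens g
| gen_id : gen_grp gens id
| gen_comp g h : gen_grp gens g -> gen_grp gens h -> gen_grp gens (g \o h)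
| gen_inv g h : gen_grp gens g -> cancel g h -> cancel h g -> gen_grp gens h
| gen_ext g h : gen_grp gens g -> g =1 h -> gen_grp gens h.

Definition qAut (B A H : hopf k) (i : B -> A) (pi : A -> H) : (B -> B) -> Prop :=
  gen_grp (fun g => exists (F : A -> A) (f : H -> H),
             [/\ hopf_auto F, hopf_auto f, forall a, pi (F a) = f (pi a)
               & forall b, i (g b) = F (i b)]).

End HopfNotions.

(* Main.v *)
(* A Hopf isomorphism [Phi : A1 -> A2] preserves the central subalgebras [K1], [K2],
   because [H] has trivial Hopf center and [K_i] is the algebra of coinvariants of
   [A_i -> H]; it therefore induces [w : K1 -> K2] and an automorphism of [H], which is
   lifted to [F]. Then [a |-> q2 (F (S a_(1))) Phi (q1 a_(2))] is again coinvariant, so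
   it takes its values in [K2] and defines [u]. Conversely the data define
   [Phi (q1 a) = q2 (F a_(1)) u(a_(2))], whose inverse is built from
   [q1 a_(1) w^-1 (u (S a_(2)))] and [F^-1].

   That [K_i] embeds in [A_i] as the coinvariants is a form of faithful flatness of [A]
   over [B]: every finitely generated [B]-submodule and right subcomodule [M] of [A] with
   [1 \in M] admits a [B]-linear retraction onto [B]. To see this, lift a basis
   [w_0 = 1, ..., w_n] of [M / B^+ M]. By Nakayama some [s] with [eps s = 1] satisfies
   [s M <= \sum B w_l]; as [M (x)_B A] is isomorphic to [(M / B^+ M) (x) A], the [w_l]
   define a matrix over [A] that is right invertible up to [s], and since [A] is
   noetherian it is injective up to a power of [s]. So the coordinate along [w_0],
   multiplied by a power of [s], is a well-defined map [M -> B], and twisting it by the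
   coaction makes it send [1] to [1]. *)
Require Import Defs.
From HB Require Import structures.
From mathcomp Require Import all_boot all_order all_algebra.
From mathcomp Require Import boolp classical_sets.
Import GRing.Theory.
Local Open Scope ring_scope.
Set Implicit Arguments. Unset Strict Implicit. Unset Printing Implicit Defensive.

(** * Linear algebra over a field *)

Section LinearAlgebra.
Variable k : fieldType.
Implicit Types U V W Z : lmodType k.

Lemma klinear0 U V (f : U -> V) : klinear f -> f 0 = 0.
Proof. by move=> lf; have := lf (-1) 0 0; rewrite scaler0 addr0 scaleN1r addNr. Qed.

Lemma klinearD U V (f : U -> V) : klinear f -> forall x y, f (x + y) = f x + f y.
Proof. by move=> lf x y; rewrite -[x in LHS]scale1r lf scale1r. Qed.

Lemma klinearZ U V (f : U -> V) : klinear f -> forall c x, f (c *: x) = c *: f x.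
Proof. by move=> lf c x; rewrite -[_ *: x]addr0 lf (klinear0 lf) addr0. Qed.

Lemma klinearN U V (f : U -> V) : klinear f -> forall x, f (- x) = - f x.
Proof. by move=> lf x; rewrite -scaleN1r (klinearZ lf) scaleN1r. Qed.

Lemma klinearB U V (f : U -> V) : klinear f -> forall x y, f (x - y) = f x - f y.
Proof. by move=> lf x y; rewrite (klinearD lf) (klinearN lf). Qed.

Lemma klinear_sum U V (f : U -> V) : klinear f ->
  forall I (r : seq I) (P : pred I) (F : I -> U),
    f (\sum_(i <- r | P i) F i) = \sum_(i <- r | P i) f (F i).
Proof.
move=> lf I r P F; elim/big_rec2: _ => [|i y x _ <-]; first exact: klinear0.
exact: klinearD.
Qed.

Lemma lin_funZ U (f : U -> k) : lin_fun f -> forall c x, f (c *: x) = c * f x.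
Proof. by move=> lf; exact: (klinearZ (V := k^o)). Qed.

Definition linear_rel V W (G : V -> W -> Prop) : Prop :=
  G 0 0 /\ forall c x y a b, G x a -> G y b -> G (c *: x + y) (c *: a + b).

(* Zorn's lemma on graphs: a maximal single-valued linear relation is total,
   because it can be extended by any pair [(x, 0)] with [x] outside its domain. *)
Lemma linear_rel_extend V W (G : V -> W -> Prop) :
  linear_rel G -> (forall a, G 0 a -> a = 0) ->
  exists2 f : V -> W, klinear f & forall x a, G x a -> f x = a.
Proof.
move=> [G00 Glin] Gfun.
pose good (X : set (V * W)) := [/\ forall x a, G x a -> X (x, a),
  linear_rel (fun x a => X (x, a)) & forall a, X (0, a) -> a = 0].
(* Zorn's lemma also tests the empty chain, whose union is empty, so [P] admits the empty set
   besides the good graphs. *)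
pose P : set (set (V * W)) := fun X => (forall z, ~ X z) \/ good X.
have [F FP Ftot|X [PX Xmax]] := @Zorn_bigcup _ P.
  have [[X0 FX0 gX0]|nog] := pselect (exists2 X, F X & good X); last first.
    left=> z [X FX Xz]; have [nX|gX] := FP _ FX; first exact: nX Xz.
    by apply: nog; exists X.
  have gF X z : F X -> X z -> good X.
    by move=> FX Xz; have [nX|//] := FP _ FX; case: (nX z).
  right; split.
  - by move=> x a Gxa; exists X0 => //; case: gX0 => GX _ _; exact: GX.
  - split; first by exists X0 => //; case: gX0 => _ [].
    move=> c x y a b [X FX Xx] [Y FY Yy].
    have [XY|YX] := Ftot _ _ FX FY.
      exists Y => //; have [_ [_ lY] _] := gF _ _ FY Yy.
      by apply: lY => //; exact: XY.
    exists X => //; have [_ [_ lX] _] := gF _ _ FX Xx.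
    by apply: lX => //; exact: YX.
  - by move=> a [X FX Xa]; have [_ _] := gF _ _ FX Xa; exact.
have gX : good X.
  case: PX => // nX.
  have gG : good (fun z => G z.1 z.2) by split.
  have := Xmax _ _ (or_intror gG); case; split; first by move=> z /nX.
  by move=> /(_ (0, 0) G00) /nX.
have [GX [X00 Xlin] Xfun] := gX.
have Xtot x : exists a, X (x, a).
  apply: contrapT => nx.
  pose Y : set (V * W) := fun z => exists c y, z.1 = c *: x + y /\ X (y, z.2).
  have XY z : X z -> Y z.
    by case: z => y a Xy; exists 0, y; rewrite scale0r add0r.
  apply: (Xmax Y); last first.
    right; split.
    - by move=> y a Gy; apply: XY; exact: GX.
    - split; first exact: XY.
      move=> c y1 y2 a b [c1 [z1 /= [-> Xz1]]] [c2 [z2 /= [-> Xz2]]].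
      exists (c * c1 + c2), (c *: z1 + z2) => /=; split; last exact: Xlin.
      by rewrite scalerDr scalerDl scalerA addrACA.
    - move=> a [c [y /= [e Xy]]]; have [c0|c0] := eqVneq c 0.
        by move: e Xy; rewrite c0 scale0r add0r => <-; exact: Xfun.
      case: nx; exists (- c^-1 *: a).
      have -> : x = - c^-1 *: y.
        have -> : y = - c *: x by apply/eqP; rewrite scaleNr -addr_eq0 addrC -e.
        by rewrite scalerA mulrNN mulVf // scale1r.
      by have := Xlin (- c^-1) _ _ _ _ Xy X00; rewrite !addr0.
  split=> // YX; apply: nx; exists 0; apply: YX.
  by exists 1, 0 => /=; rewrite scale1r addr0.
have [f fP] := choice Xtot.
have Xu x a b : X (x, a) -> X (x, b) -> a = b.
  move=> Xa Xb; have := Xlin (-1) _ _ _ _ Xa Xb.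
  by rewrite !scaleN1r addNr => /Xfun; rewrite addrC => /eqP; rewrite subr_eq0 => /eqP.
exists f => [c x y|x a Gx]; last exact: Xu (fP x) (GX _ _ Gx).
exact: Xu (fP _) (Xlin _ _ _ _ _ (fP x) (fP y)).
Qed.

(** Injectivity of [j] makes the graph of all pairs (j u, f u) single-valued, so it extends to all
    of [V]. *)
Lemma klinear_extend U V W (j : U -> V) (f : U -> W) :
  klinear j -> injective j -> klinear f ->
  exists2 h : V -> W, klinear h & forall x, h (j x) = f x.
Proof.
move=> lj ij lf.
have [||h lh hP] := @linear_rel_extend V W (fun x a => exists2 u, x = j u & a = f u).
- split; first by exists 0; rewrite klinear0.
  by move=> c _ _ _ _ [u1 -> ->] [u2 -> ->]; exists (c *: u1 + u2); rewrite ?lj ?lf.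
- by move=> _ [u + ->]; rewrite -(klinear0 lj) => /ij <-; rewrite klinear0.
by exists h => // x; apply: hP; exists x.
Qed.

(** * Independence modulo a subspace and dual functionals *)

Definition subspace V (P : V -> Prop) : Prop :=
  P 0 /\ forall c x y, P x -> P y -> P (c *: x + y).

Definition lcomb V (w : seq V) (c : nat -> k) : V :=
  \sum_(l < size w) c l *: w`_l.

(** Linear independence of the classes in V/P, phrased without the quotient space. *)
Definition indep_mod V (P : V -> Prop) (w : seq V) : Prop :=
  forall c, P (lcomb w c) -> forall l, (l < size w)%N -> c l = 0.

Lemma lcomb_lin V (w : seq V) a c d :
  lcomb w (fun l => a * c l + d l) = a *: lcomb w c + lcomb w d.
Proof.
rewrite /lcomb scaler_sumr -big_split; apply: eq_bigr => l _ /=.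
by rewrite scalerDl scalerA.
Qed.

Lemma lcomb0 V (w : seq V) : lcomb w (fun=> 0) = 0.
Proof. by rewrite /lcomb big1 // => l _; rewrite scale0r. Qed.

Lemma lcomb_delta V (w : seq V) (j : nat) : (j < size w)%N ->
  lcomb w (fun l => (l == j)%:R) = w`_j.
Proof.
move=> jw; rewrite /lcomb (bigD1 (Ordinal jw)) //= eqxx scale1r big1 ?addr0 //.
by move=> l; rewrite -val_eqE /= => /negbTE ->; rewrite scale0r.
Qed.

Lemma lcomb_rcons V (w : seq V) x c :
  lcomb (rcons w x) c = lcomb w c + c (size w) *: x.
Proof.
rewrite /lcomb size_rcons big_ord_recr /= nth_rcons ltnn eqxx; congr (_ + _).
by apply: eq_bigr => l _; rewrite nth_rcons ltn_ord.
Qed.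

Lemma klinear_lcomb U V (f : U -> V) (w : seq U) c : klinear f ->
  f (lcomb w c) = \sum_(l < size w) c l *: f w`_l.
Proof.
by move=> lf; rewrite (klinear_sum lf); apply: eq_bigr => l _; rewrite (klinearZ lf).
Qed.

Lemma subspaceZ V (P : V -> Prop) : subspace P -> forall c x, P x -> P (c *: x).
Proof. by move=> [P0 Pl] c x Px; rewrite -[_ *: x]addr0; exact: Pl. Qed.

Lemma subspaceD V (P : V -> Prop) : subspace P -> forall x y, P x -> P y -> P (x + y).
Proof. by move=> [P0 Pl] x y Px Py; rewrite -[x]scale1r; exact: Pl. Qed.

Lemma subspace_sum V (P : V -> Prop) : subspace P ->
  forall (I : eqType) (r : seq I) (F : I -> V),
    (forall l, l \in r -> P (F l)) -> P (\sum_(l <- r) F l).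
Proof.
move=> sP I r F rF; rewrite big_seq; elim/big_rec: _ => [|l x lr Px]; first exact: sP.1.
by apply: subspaceD => //; exact: rF.
Qed.

Lemma subspace_eq0 V : subspace (fun x : V => x = 0).
Proof. by split=> // c x y -> ->; rewrite scaler0 addr0. Qed.

(** Steinitz extension: an element of [L] is adjoined only when it is not yet in the span modulo
    [P]. Keeping [w] as a prefix lets a chosen vector, later 1, stay first in the basis. *)
Lemma indep_mod_extend V (P : V -> Prop) (w : seq V) : subspace P ->
  indep_mod P w -> forall L : seq V, exists w' : seq V,
  [/\ indep_mod P (w ++ w'), {subset w' <= L}
    & forall x, x \in L -> exists c, P (x - lcomb (w ++ w') c)].
Proof.
move=> sP iw; elim/last_ind => [|L y [w' [iw' w'L Lw']]].
  by exists [::]; rewrite cats0.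
have [[c yc]|ny] := pselect (exists c, P (y - lcomb (w ++ w') c)).
  exists w'; split=> // x; first by move/w'L; rewrite mem_rcons inE orbC => ->.
  by rewrite mem_rcons inE => /orP[/eqP ->|/Lw' //]; exists c.
exists (rcons w' y); split.
- move=> c; rewrite -rcons_cat lcomb_rcons size_rcons => Pc.
  have cy0 : c (size (w ++ w')) = 0.
    apply: contrapT => /eqP cn0; apply: ny; set n := size _ in cn0 Pc.
    exists (fun l => (- (c n)^-1) * c l + 0); rewrite lcomb_lin lcomb0 addr0.
    rewrite scaleNr opprK; have := subspaceZ sP (c n)^-1 Pc.
    by rewrite scalerDr scalerA mulVf // scale1r addrC.
  move: Pc; rewrite cy0 scale0r addr0 => Pc l; rewrite ltnS leq_eqVlt.
  by move=> /orP[/eqP -> //|]; exact: iw'.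
- move=> x; rewrite !mem_rcons !inE => /orP[->//|/w'L ->]; by rewrite orbT.
move=> x; rewrite mem_rcons inE => /orP[/eqP ->|/Lw' [c Pc]].
  exists (fun l => (l == size (w ++ w'))%:R); rewrite -rcons_cat lcomb_rcons eqxx scale1r.
  rewrite /lcomb big1 ?add0r ?subrr; first exact: sP.1.
  by move=> l _; rewrite ltn_eqF ?scale0r.
exists (fun l => if (l < size (w ++ w'))%N then c l else 0).
rewrite -rcons_cat lcomb_rcons ltnn scale0r addr0.
suff -> : lcomb (w ++ w') (fun l => if (l < size (w ++ w'))%N then c l else 0)
  = lcomb (w ++ w') c by [].
by apply: eq_bigr => l _; rewrite ltn_ord.
Qed.

Lemma indep_mod_nil V (P : V -> Prop) : indep_mod P [::].
Proof. by []. Qed.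

(** Independence makes the [j]-th coordinate well defined on [P] plus the span of [w]; this partial
    functional is then extended. *)
Lemma dual_functional V (P : V -> Prop) (w : seq V) : subspace P -> indep_mod P w ->
  forall j, (j < size w)%N -> exists f : V -> k,
  [/\ lin_fun f, forall x, P x -> f x = 0
    & forall l, (l < size w)%N -> f w`_l = (l == j)%:R].
Proof.
move=> sP iw j jw.
have [||f lf fP] := @linear_rel_extend V k^o
  (fun x a => exists c, P (x - lcomb w c) /\ a = c j).
- split; first by exists (fun=> 0); rewrite lcomb0 subr0; split => //; exact: sP.1.
  move=> a x y _ _ [c [Px ->]] [d [Py ->]].
  exists (fun l => a * c l + d l); split => //; rewrite lcomb_lin.
  by rewrite opprD addrACA -scalerBr; exact: sP.2.
- move=> a [c [Pc ->]]; have := subspaceZ sP (-1) Pc.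
  by rewrite sub0r scaleN1r opprK => /iw; exact.
exists f; split=> [||l lw] //.
  by move=> x Px; apply: fP; exists (fun=> 0); rewrite lcomb0 subr0.
apply: fP; exists (fun m => (m == l)%:R); rewrite lcomb_delta // subrr eq_sym.
by split => //; exact: sP.1.
Qed.

Lemma functional_separates V (x : V) : (forall f, lin_fun f -> f x = 0) -> x = 0.
Proof.
move=> fx; apply: contrapT => /eqP x0.
have i1 : indep_mod (fun y : V => y = 0) [:: x].
  move=> c; rewrite /lcomb big_ord_recl big_ord0 /= addr0 => /eqP.
  by rewrite scaler_eq0 (negbTE x0) orbF => /eqP c0 [].
have [f [lf _ /(_ 0%N isT)]] := dual_functional (subspace_eq0 V) i1 (ltn0Sn 0).
by rewrite /= fx // => /esym/eqP; rewrite oner_eq0.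
Qed.

(** * Tensors as lists of pairs: evaluation of bilinear and trilinear maps *)

Definition bilin U V W (f : U -> V -> W) : Prop :=
  (forall y, klinear (f^~ y)) /\ (forall x, klinear (f x)).

Definition trilin U V W Z (f : U -> V -> W -> Z) : Prop :=
  [/\ forall y z, klinear (fun x => f x y z), forall x z, klinear (fun y => f x y z)
    & forall x y, klinear (f x y)].

Lemma indep_basis V (L : seq V) : exists (w : seq V) (c : V -> nat -> k),
  indep_mod (fun x => x = 0) w /\ forall x, x \in L -> x = lcomb w (c x).
Proof.
have [w [iw _ wL]] :=
  indep_mod_extend (subspace_eq0 V) (@indep_mod_nil V (fun x => x = 0)) L.
have [c cP] : {c : V -> nat -> k & forall x, x \in L -> x = lcomb w (c x)}.
  apply: (@choice _ _ (fun x c => x \in L -> x = lcomb w c)) => x.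
  have [/wL [c /eqP]|_] := boolP (x \in L); last by exists (fun=> 0).
  by rewrite subr_eq0 => /eqP ->; exists c.
by exists w, c.
Qed.

(** The tensor given by [s] is rewritten as a sum of x_l (x) w_l with independent w_l; quantifying
    over all bilinear [f] stands for equality in the tensor product. *)
Lemma tensor_reduce U V (s : seq (U * V)) : exists (w : seq V) (x : nat -> U),
  indep_mod (fun y => y = 0) w /\
  forall W (f : U -> V -> W), bilin f ->
    \sum_(p <- s) f p.1 p.2 = \sum_(l < size w) f (x l) w`_l.
Proof.
have [w [c [iw wP]]] := indep_basis [seq p.2 | p <- s].
exists w, (fun l => \sum_(p <- s) c p.2 l *: p.1); split=> // W f [fl fr].
under [RHS]eq_bigr => l _.
  rewrite (klinear_sum (fl _)); under eq_bigr => p _ do rewrite (klinearZ (fl _)).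
  over.
rewrite exchange_big /= big_seq [RHS]big_seq; apply: eq_bigr => p ps.
by rewrite {1}(wP p.2) ?map_f // (klinear_lcomb _ _ (fr _)).
Qed.

(** The universal property, recovered from functionals. Write the difference of [s] and [t] with
    independent second legs; pairing with dual functionals shows that every functional kills each
    first leg, which is therefore zero. *)
Lemma teq_bilin U V W (s t : seq (U * V)) (f : U -> V -> W) :
  teq s t -> bilin f -> \sum_(p <- s) f p.1 p.2 = \sum_(p <- t) f p.1 p.2.
Proof.
move=> st bf; pose t' := [seq (- p.1, p.2) | p <- t].
have eB Z (h : U -> V -> Z) : bilin h -> \sum_(p <- s ++ t') h p.1 p.2
    = \sum_(p <- s) h p.1 p.2 - \sum_(p <- t) h p.1 p.2.
  move=> [hl _]; rewrite big_cat big_map -sumrN; congr (_ + _).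
  by apply: eq_bigr => p _; rewrite (klinearN (hl _)).
have [w [x [iw wP]]] := tensor_reduce (s ++ t').
apply/eqP; rewrite -subr_eq0 -eB // wP // big1 // => l _.
suff -> : x l = 0 by rewrite (klinear0 (bf.1 _)).
apply: functional_separates => g lg.
have [h [lh _ hw]] := dual_functional (subspace_eq0 V) iw (ltn_ord l).
have bgh : bilin (fun a b => g a * h b : k^o).
  split=> [b c a a'|a c b b']; first by rewrite lg mulrDl -mulrA.
  by rewrite lh mulrDr mulrCA.
have := eB _ _ bgh; rewrite (st g h lg lh) subrr (wP _ _ bgh).
rewrite (bigD1 l) //= hw // eqxx mulr1 big1 ?addr0 // => j.
by rewrite -val_eqE /= => /negbTE jl; rewrite hw // jl mulr0.
Qed.

(** Expand the first legs in an independent family and apply a dual functional: each coefficient is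
    an identity of two-legged tensors, to which [teq_bilin] applies. *)
Lemma teq3_trilin U V W Z (s t : seq (U * V * W)) (f : U -> V -> W -> Z) :
  teq3 s t -> trilin f ->
  \sum_(p <- s) f p.1.1 p.1.2 p.2 = \sum_(p <- t) f p.1.1 p.1.2 p.2.
Proof.
move=> st [f1 f2 f3].
have [w [c [iw wP]]] := indep_basis [seq p.1.1 | p <- s ++ t].
have E r : {subset r <= s ++ t} -> \sum_(p <- r) f p.1.1 p.1.2 p.2 =
    \sum_(l < size w) \sum_(p <- r) f w`_l (c p.1.1 l *: p.1.2) p.2.
  move=> rst; rewrite exchange_big /= big_seq [RHS]big_seq.
  apply: eq_bigr => p /rst ps.
  rewrite [in LHS](wP p.1.1) ?(map_f (fun q => q.1.1)) // (klinear_lcomb _ _ (f1 p.1.2 p.2)).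
  by apply: eq_bigr => l _; rewrite (klinearZ (f2 _ _)).
have D l (r : seq (U * V * W)) : (l < size w)%N -> {subset r <= s ++ t} ->
    forall g, lin_fun g -> (forall j, (j < size w)%N -> g w`_j = (j == l)%:R) ->
    \sum_(p <- r) f w`_l (c p.1.1 l *: p.1.2) p.2 =
    \sum_(p <- [seq (g q.1.1 *: q.1.2, q.2) | q <- r]) f w`_l p.1 p.2.
  move=> lw rst g lg gw; rewrite big_map big_seq [RHS]big_seq.
  apply: eq_bigr => p /rst ps; congr (f _ (_ *: _) _).
  rewrite [in RHS](wP p.1.1) ?(map_f (fun q => q.1.1)) // (klinear_lcomb (V := k^o) _ _ lg).
  rewrite (bigD1 (Ordinal lw)) //= gw // eqxx [_ *: _]mulr1 big1 ?addr0 // => j.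
  by rewrite -val_eqE /= => /negbTE jl; rewrite gw // jl scaler0.
have ss : {subset s <= s ++ t} by move=> p; rewrite mem_cat => ->.
have tt : {subset t <= s ++ t} by move=> p; rewrite mem_cat orbC => ->.
rewrite !E //; apply: eq_bigr => l _.
have [g [lg _ gw]] := dual_functional (subspace_eq0 U) iw (ltn_ord l).
rewrite !(D l _ _ _ g) //; apply: teq_bilin; last by split.
move=> h h' lh lh'; rewrite !big_map.
under eq_bigr do rewrite /= lin_funZ //; under [RHS]eq_bigr do rewrite /= lin_funZ //.
exact: st.
Qed.

(** A tensor product of injections is injective, since functionals on [U] and [V] extend along [j]
    and [j']. *)
Lemma teq_sep U V U' V' (j : U -> U') (j' : V -> V') (s t : seq (U * V)) :
  klinear j -> injective j -> klinear j' -> injective j' ->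
  teq [seq (j p.1, j' p.2) | p <- s] [seq (j p.1, j' p.2) | p <- t] -> teq s t.
Proof.
move=> lj ij lj' ij' st f g lf lg.
have [f' lf' f'P] := klinear_extend (W := k^o) lj ij lf.
have [g' lg' g'P] := klinear_extend (W := k^o) lj' ij' lg.
have := st f' g' lf' lg'; rewrite !big_map /=.
by under eq_bigr do rewrite f'P g'P; under [RHS]eq_bigr do rewrite f'P g'P.
Qed.

End LinearAlgebra.

(** * Sweedler sums *)

(** Sweedler's f(a_(1), a_(2)); for bilinear [f] the value depends only on the tensor and not on the
    list representing it. *)
Definition sw (k : fieldType) (A : hopf k) (W : lmodType k) (a : A)
  (f : A -> A -> W) : W := \sum_(p <- cm A a) f p.1 p.2.

Section Linearity.
Variable k : fieldType.
Implicit Types (U V W : lmodType k) (R : algType k) (A B : hopf k).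

Lemma klinear_id U : klinear (fun x : U => x). Proof. by []. Qed.

Lemma klinear_comp U V W (f : V -> W) (g : U -> V) :
  klinear f -> klinear g -> klinear (fun x => f (g x)).
Proof. by move=> lf lg c x y; rewrite lg lf. Qed.

Lemma klinear_mull U R (f : U -> R) (c : R) : klinear f -> klinear (fun x => f x * c).
Proof. by move=> lf a x y; rewrite lf mulrDl scalerAl. Qed.

Lemma klinear_mulr U R (f : U -> R) (c : R) : klinear f -> klinear (fun x => c * f x).
Proof. by move=> lf a x y; rewrite lf mulrDr scalerAr. Qed.

Lemma klinear_scaler U V (f : U -> V) (c : k) : klinear f -> klinear (fun x => c *: f x).
Proof. by move=> lf a x y; rewrite lf scalerDr !scalerA mulrC. Qed.

Lemma klinear_scalel U V (f : U -> k) (c : V) :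
  lin_fun f -> klinear (fun x => f x *: c).
Proof. by move=> lf a x y; rewrite lf scalerDl scalerA. Qed.

Lemma klinear_opp U V (f : U -> V) : klinear f -> klinear (fun x => - f x).
Proof. by move=> lf a x y; rewrite lf opprD scalerN. Qed.

Lemma klinear_sumf U V I (r : seq I) (f : U -> I -> V) :
  (forall l, klinear (f^~ l)) -> klinear (fun x => \sum_(l <- r) f x l).
Proof.
move=> lf a x y; rewrite scaler_sumr -big_split.
by apply: eq_bigr => l _; exact: lf.
Qed.

Lemma lin_fun_comp U V (f : V -> k) (g : U -> V) :
  lin_fun f -> klinear g -> lin_fun (fun x => f (g x)).
Proof. by move=> lf lg c x y; rewrite lg lf. Qed.

Lemma lin_fun_mull U (f : U -> k) (c : k) : lin_fun f -> lin_fun (fun x => f x * c).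
Proof. by move=> lf a x y; rewrite lf mulrDl mulrA. Qed.

Lemma lin_fun_mulr U (f : U -> k) (c : k) : lin_fun f -> lin_fun (fun x => c * f x).
Proof. by move=> lf a x y; rewrite lf mulrDr mulrCA. Qed.

Lemma alg_klinear R R' (f : R -> R') : alg_map f -> klinear f.
Proof. by case. Qed.

Lemma hopf_alg A B (f : A -> B) : hopf_map f -> alg_map f.
Proof. by case. Qed.

Lemma hopf_klinear A B (f : A -> B) : hopf_map f -> klinear f.
Proof. by move/hopf_alg/alg_klinear. Qed.

Lemma ap_klinear A : klinear (ap A). Proof. by case: (hopfP A). Qed.

Lemma cu_lin_fun A : lin_fun (cu A). Proof. by case: (hopfP A). Qed.

Lemma klinear_sw A U W (a : A) (f : U -> A -> A -> W) :
  (forall y z, klinear (fun x => f x y z)) -> klinear (fun x => sw a (f x)).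
Proof. by move=> lf; apply: klinear_sumf => l; exact: lf. Qed.

Lemma sw_klinear A W (f : A -> A -> W) : bilin f -> klinear (fun a => sw a f).
Proof.
move=> bf c x y; rewrite /sw (teq_bilin (cm_lin (hopfP A) c x y) bf) big_cat big_map.
rewrite scaler_sumr; congr (_ + _); apply: eq_bigr => p _ /=.
by rewrite (klinearZ (bf.1 _)).
Qed.

Lemma klinear_sw_comp A U W (g : U -> A) (f : A -> A -> W) :
  bilin f -> klinear g -> klinear (fun x => sw (g x) f).
Proof. by move=> bf lg; exact: (klinear_comp (sw_klinear bf) lg). Qed.

Lemma bilin_l U V W (f : U -> V -> W) : bilin f -> forall y, klinear (f^~ y).
Proof. by case. Qed.

Lemma bilin_r U V W (f : U -> V -> W) : bilin f -> forall x, klinear (f x).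
Proof. by case. Qed.

End Linearity.

Ltac klin_side := first
  [ assumption
  | by eauto using hopf_klinear, alg_klinear, ap_klinear, cu_lin_fun, bilin_r ].

(** Proves linearity by recursion on the shape of the map; the second-order patterns detect which
    factor of a product is constant in the variable. *)
Ltac klin := cbv beta; lazymatch goal with
  | |- bilin _ => split=> ?; klin
  | |- trilin _ => split=> ? ?; klin
  | |- klinear (fun x => x) => exact: klinear_id
  | |- klinear (fun x => (@?f x) * (@?g x)) =>
      lazymatch g with
      | (fun _ => ?c) => apply: (klinear_mull (f := f) c); klin
      | _ => lazymatch f with (fun _ => ?c) => apply: (klinear_mulr (f := g) c); klin end
      end
  | |- klinear (fun x => (@?f x) *: (@?g x)) =>
      lazymatch g with
      | (fun _ => ?c) => apply: (klinear_scalel (f := f) c); klin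
      | _ => lazymatch f with (fun _ => ?c) => apply: (klinear_scaler (f := g) c); klin end
      end
  | |- klinear (fun x => - (@?f x)) => apply: (klinear_opp (f := f)); klin
  | |- klinear (fun x => sw (@?g x) (@?f x)) =>
      lazymatch g with
      | (fun _ => ?a) => apply: (klinear_sw (f := f) a) => ? ?; klin
      | _ => lazymatch f with
             (fun _ => ?h) => apply: (klinear_sw_comp (g := g) (f := h)); klin end
      end
  | |- lin_fun (fun x => (@?f x) * (@?g x)) =>
      lazymatch g with
      | (fun _ => ?c) => apply: (lin_fun_mull (f := f) c); klin
      | _ => lazymatch f with (fun _ => ?c) => apply: (lin_fun_mulr (f := g) c); klin end
      end
  | H : bilin ?f |- klinear (fun x => ?f (@?g x) (@?h x)) =>
      lazymatch h with
      | (fun _ => ?c) => apply: (klinear_comp (g := g) (bilin_l H c)); klin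
      | _ => lazymatch g with
             (fun _ => ?c) => apply: (klinear_comp (g := h) (bilin_r H c)); klin end
      end
  | |- klinear (fun x => ?f x) => klin_side
  | |- lin_fun (fun x => ?f x) => klin_side
  | |- klinear (fun x => ?f (@?g x)) => apply: (klinear_comp (f := f) (g := g)); klin
  | |- lin_fun (fun x => ?f (@?g x)) => apply: (lin_fun_comp (f := f) (g := g)); klin
  | |- _ => klin_side
  end.

Section Sweedler.
Variable k : fieldType.
Implicit Types (U V W : lmodType k) (R : algType k) (A B : hopf k).

Lemma eq_sw A W (a : A) (f g : A -> A -> W) :
  (forall x y, f x y = g x y) -> sw a f = sw a g.
Proof. by move=> fg; apply: eq_bigr => p _; exact: fg. Qed.

Lemma sw_teq A W (a : A) (s : seq (A * A)) (f : A -> A -> W) :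
  teq s (cm A a) -> bilin f -> sw a f = \sum_(p <- s) f p.1 p.2.
Proof. by move=> sa bf; rewrite (teq_bilin sa bf). Qed.

Lemma sw_out A V W (a : A) (h : V -> W) (f : A -> A -> V) :
  klinear h -> h (sw a f) = sw a (fun x y => h (f x y)).
Proof. by move=> lh; rewrite /sw (klinear_sum lh). Qed.

Lemma sw_exchange A B W (a : A) (b : B) (f : A -> A -> B -> B -> W) :
  sw a (fun x y => sw b (fun z t => f x y z t)) =
  sw b (fun z t => sw a (fun x y => f x y z t)).
Proof. exact: exchange_big. Qed.

Lemma sw_sum A W I (r : seq I) (a : A) (f : A -> A -> I -> W) :
  sw a (fun x y => \sum_(p <- r) f x y p) = \sum_(p <- r) sw a (fun x y => f x y p).
Proof. exact: exchange_big. Qed.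

Lemma swA A W (a : A) (f : A -> A -> A -> W) : trilin f ->
  sw a (fun x z => sw x (fun x y => f x y z)) = sw a (fun x y => sw y (fun y z => f x y z)).
Proof.
move=> tf; have := teq3_trilin (cm_coassoc (hopfP A) a) tf.
rewrite /sw !big_flatten !big_map => e; symmetry; move: e.
under eq_bigr do rewrite big_map; under [RHS]eq_bigr do rewrite big_map.
exact.
Qed.

Lemma sw_counitl A W (a : A) (f : A -> W) : klinear f ->
  sw a (fun x y => cu A x *: f y) = f a.
Proof.
move=> lf; rewrite -[in RHS](counit_l (hopfP A) a) (klinear_sum lf).
by apply: eq_bigr => p _; rewrite (klinearZ lf).
Qed.

Lemma sw_counitr A W (a : A) (f : A -> W) : klinear f ->
  sw a (fun x y => cu A y *: f x) = f a.
Proof.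
move=> lf; rewrite -[in RHS](counit_r (hopfP A) a) (klinear_sum lf).
by apply: eq_bigr => p _; rewrite (klinearZ lf).
Qed.

Lemma sw_apl A W (a : A) (f : A -> W) : klinear f ->
  sw a (fun x y => f (ap A x * y)) = cu A a *: f 1.
Proof.
by move=> lf; rewrite /sw -(klinear_sum lf) (antipode_l (hopfP A)) (klinearZ lf).
Qed.

Lemma sw_apr A W (a : A) (f : A -> W) : klinear f ->
  sw a (fun x y => f (x * ap A y)) = cu A a *: f 1.
Proof.
by move=> lf; rewrite /sw -(klinear_sum lf) (antipode_r (hopfP A)) (klinearZ lf).
Qed.

Lemma sw_one A W (f : A -> A -> W) : bilin f -> sw (1 : A) f = f 1 1.
Proof. by move=> bf; rewrite /sw (teq_bilin (cm_one (hopfP A)) bf) big_seq1. Qed.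

Lemma sw_mul A W (a b : A) (f : A -> A -> W) : bilin f ->
  sw (a * b) f = sw a (fun x y => sw b (fun z t => f (x * z) (y * t))).
Proof.
move=> bf; rewrite /sw (teq_bilin (cm_mul (hopfP A) a b) bf) big_flatten big_map.
by apply: eq_bigr => p _; rewrite big_map.
Qed.

Lemma sw_map A B W (h : A -> B) (a : A) (f : B -> B -> W) : hopf_map h -> bilin f ->
  sw (h a) f = sw a (fun x y => f (h x) (h y)).
Proof. by move=> [_ hh _] bf; rewrite /sw (teq_bilin (hh a) bf) big_map. Qed.

Lemma sw_apl_head A W (a : A) (f : A -> A -> W) : bilin f ->
  sw a (fun x y => sw y (fun y z => f (ap A x * y) z)) = f 1 a.
Proof.
move=> bf; have [f1 f2] := bf; rewrite -swA; last by klin.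
under eq_sw => x y do rewrite (sw_apl _ (f := fun z => f z y)) //.
by rewrite sw_counitl.
Qed.

Lemma sw_apr_head A W (a : A) (f : A -> A -> W) : bilin f ->
  sw a (fun x y => sw y (fun y z => f (x * ap A y) z)) = f 1 a.
Proof.
move=> bf; have [f1 f2] := bf; rewrite -swA; last by klin.
under eq_sw => x y do rewrite (sw_apr _ (f := fun z => f z y)) //.
by rewrite sw_counitl.
Qed.

Lemma sw_apl_tail A W (a : A) (f : A -> A -> W) : bilin f ->
  sw a (fun x y => sw y (fun y z => f x (ap A y * z))) = f a 1.
Proof.
move=> [f1 f2]; under eq_sw => x y do rewrite sw_apl //.
by rewrite (sw_counitr _ (f1 1)).
Qed.

Lemma sw_apr_tail A W (a : A) (f : A -> A -> W) : bilin f ->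
  sw a (fun x y => sw y (fun y z => f x (y * ap A z))) = f a 1.
Proof.
move=> [f1 f2]; under eq_sw => x y do rewrite sw_apr //.
by rewrite (sw_counitr _ (f1 1)).
Qed.

End Sweedler.

(** * Antipode and convolution *)

Section Antipode.
Variable k : fieldType.
Implicit Types (W : lmodType k) (R : algType k) (A B C : hopf k).

Lemma ap1 A : ap A 1 = 1.
Proof.
have := antipode_l (hopfP A) 1; rewrite (cu_one (hopfP A)) scale1r => e.
by rewrite -[RHS]e -/(sw 1 (fun x y => ap A x * y)) sw_one ?mulr1 //; klin.
Qed.

(* Both sides are convolution inverses of the multiplication [A (x) A -> A]. *)
Lemma apM A (a b : A) : ap A (a * b) = ap A b * ap A a.
Proof.
pose T a1 a2 a3 b1 b2 b3 :=
  ap A (a1 * b1) * (a2 * b2) * (ap A b3 * ap A a3).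
transitivity (sw a (fun a1 a' => sw a' (fun a2 a3 =>
  sw b (fun b1 b' => sw b' (fun b2 b3 => T a1 a2 a3 b1 b2 b3))))).
  under [RHS]eq_sw => a1 a'.
    under eq_sw => a2 a3.
      under eq_sw => b1 b'.
        under eq_sw => b2 b3.
          rewrite /T -mulrA [a2 * b2 * _]mulrA -[a2 * b2 * _]mulrA -[a2 * _ * _]mulrA; over.
        over.
      rewrite (sw_apr_tail b
        (f := fun b1 z => ap A (a1 * b1) * (a2 * (z * ap A a3)))); last by klin.
      rewrite mul1r; over.
    over.
  by rewrite (sw_apr_tail a (f := fun a1 z => ap A (a1 * b) * z)) ?mulr1 //; klin.
transitivity (sw a (fun a12 a3 => sw b (fun b12 b3 =>
  sw (a12 * b12) (fun u v => ap A u * v) * (ap A b3 * ap A a3)))).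
  rewrite -(swA a (f := fun a1 a2 a3 => _)); last by rewrite /T; klin.
  apply: eq_sw => a12 a3.
  rewrite sw_exchange.
  under eq_sw => b1 b' do rewrite sw_exchange.
  rewrite -(swA b (f := fun b1 b2 b3 => _)); last by rewrite /T; klin.
  apply: eq_sw => b12 b3.
  rewrite sw_exchange (sw_out _ _ (klinear_mull _ (@klinear_id _ A))) sw_mul; last by klin.
  by [].
under eq_sw => a12 a3.
  under eq_sw => b12 b3.
    rewrite (sw_apl _ (@klinear_id _ A)) (cu_mul (hopfP A)) mulr_algl -scalerA; over.
  rewrite -(sw_out _ _ (klinear_scaler _ (@klinear_id _ A))).
  rewrite (sw_counitl b (f := fun b3 => ap A b3 * ap A a3)); last by klin.
  over.
by rewrite (sw_counitl a (f := fun a3 => ap A b * ap A a3)) //; klin.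
Qed.

(** Both sides are convolution inverses of the comultiplication: [T] expands (S a_(2) (x) S a_(1))
    Delta(a_(3)) Delta(S a_(4)), which collapses from the left or from the right. *)
Lemma sw_ap A W (a : A) (f : A -> A -> W) : bilin f ->
  sw (ap A a) f = sw a (fun x y => f (ap A y) (ap A x)).
Proof.
move=> bf.
pose T a1 a2 a3 a4 a5 :=
  sw (ap A a5) (fun u v => f (ap A a2 * a3 * u) (ap A a1 * a4 * v)).
transitivity (sw a (fun a1 b => sw b (fun a2 b => sw b (fun a3 b => sw b (fun a4 a5 =>
  T a1 a2 a3 a4 a5))))).
  under [RHS]eq_sw => a1 b.
    rewrite (sw_apl_head b (f := fun z b =>
      sw b (fun a4 a5 => sw (ap A a5) (fun u v => f (z * u) (ap A a1 * a4 * v)))));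
      last by klin.
    over.
  rewrite (sw_apl_head a (f := fun z b =>
      sw (ap A b) (fun u v => f (1 * u) (z * v)))); last by klin.
  by apply: eq_sw => u v; rewrite !mul1r.
apply: eq_sw => a1 b.
pose h a2 z := sw z (fun u v => f (ap A a2 * u) (ap A a1 * v)).
transitivity (sw b (fun a2 b => sw b (fun a34 a5 => h a2 (a34 * ap A a5)))).
  apply: eq_sw => a2 {}b; rewrite -(swA b (f := fun a3 a4 a5 => T _ _ a3 a4 a5));
    last by rewrite /T; klin.
  apply: eq_sw => a34 a5; rewrite /h sw_mul; last by klin.
  by apply: eq_sw => a3 a4; apply: eq_sw => u v; rewrite !mulrA.
rewrite sw_apr_tail /h ?sw_one ?mulr1 //; klin.
Qed.

(** Both sides are convolution inverses of [f]: the sum of S(f a_(1)) f(a_(2)) f(S a_(3)) collapses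
    in two ways. *)
Lemma ap_hopf_map A B (f : A -> B) (a : A) : hopf_map f -> ap B (f a) = f (ap A a).
Proof.
move=> hf; have [[lf fM f1] _ fcu] := hf.
transitivity (sw a (fun x y => sw y (fun y z => ap B (f x) * f (y * ap A z)))).
  rewrite (sw_apr_tail a (f := fun x z => ap B (f x) * f z)) ?f1 ?mulr1 //; klin.
under eq_sw => x y do under eq_sw => y' z do rewrite fM mulrA.
rewrite -(swA a (f := fun x y z => _)); last by klin.
under eq_sw => x y.
  rewrite -(sw_map _ (f := fun u v => ap B u * v * f (ap A y)) hf); last by klin.
  rewrite (sw_apl _ (f := fun w => w * f (ap A y))); last by klin.
  rewrite fcu mul1r; over.
by rewrite (sw_counitl a (f := fun y => f (ap A y))) //; klin.
Qed.

(** * Convolution of linear maps, and factorization through surjections *)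

Definition conv A R (f g : A -> R) : A -> R := fun a => sw a (fun x y => f x * g y).

Lemma klinear_conv A R (f g : A -> R) : klinear f -> klinear g -> klinear (conv f g).
Proof. by move=> lf lg; rewrite /conv; klin. Qed.

Lemma convA A R (f g h : A -> R) : klinear f -> klinear g -> klinear h ->
  conv f (conv g h) =1 conv (conv f g) h.
Proof.
move=> lf lg lh a; rewrite /conv.
under [RHS]eq_sw => x y do rewrite (sw_out _ _ (klinear_mull _ (@klinear_id _ _))).
rewrite (swA a (f := fun x y z => f x * g y * h z)); last by klin.
apply: eq_sw => x y; rewrite (sw_out _ _ (klinear_mulr _ (@klinear_id _ _))).
by apply: eq_sw => z t; rewrite mulrA.
Qed.

Lemma conv_unitl A R (f : A -> R) : klinear f ->
  conv (fun a => (cu A a)%:A) f =1 f.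
Proof.
by move=> lf a; rewrite -(sw_counitl a lf); apply: eq_sw => x y; rewrite mulr_algl.
Qed.

Lemma conv_unitr A R (f : A -> R) : klinear f ->
  conv f (fun a => (cu A a)%:A) =1 f.
Proof.
by move=> lf a; rewrite -(sw_counitr a lf); apply: eq_sw => x y; rewrite mulr_algr.
Qed.

Lemma eq_conv A R (f f' g g' : A -> R) : f =1 f' -> g =1 g' -> conv f g =1 conv f' g'.
Proof. by move=> ff gg a; apply: eq_sw => x y; rewrite ff gg. Qed.

Lemma conv_out A R R' (h : R -> R') (f g : A -> R) : alg_map h ->
  h \o conv f g =1 conv (h \o f) (h \o g).
Proof.
by move=> [lh hM _] a; rewrite /= /conv (sw_out _ _ lh); apply: eq_sw => x y; rewrite hM.
Qed.

Lemma conv_in A B R (h : A -> B) (f g : B -> R) : hopf_map h -> klinear f -> klinear g ->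
  conv f g \o h =1 conv (f \o h) (g \o h).
Proof. by move=> hh lf lg a; rewrite /= /conv sw_map //; klin. Qed.

Lemma alg_map_scalar R R' (f : R -> R') (c : k) : alg_map f -> f c%:A = c%:A.
Proof. by move=> [lf _ f1]; rewrite (klinearZ lf) f1. Qed.

Lemma conv_apr A R (f : A -> R) : alg_map f ->
  conv f (f \o ap A) =1 (fun a => (cu A a)%:A).
Proof.
move=> af a; have [lf fM f1] := af; rewrite /conv /=.
by under eq_sw => x y do rewrite -fM; rewrite sw_apr // f1.
Qed.

Lemma conv_apl A R (f : A -> R) : alg_map f ->
  conv (f \o ap A) f =1 (fun a => (cu A a)%:A).
Proof.
move=> af a; have [lf fM f1] := af; rewrite /conv /=.
by under eq_sw => x y do rewrite -fM; rewrite sw_apl // f1.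
Qed.

Lemma conv_alg_map A R (f g : A -> R) : alg_map f -> alg_map g ->
  (forall x y, f x * g y = g y * f x) -> alg_map (conv f g).
Proof.
move=> af ag fg; have [lf fM f1] := af; have [lg gM g1] := ag; split.
- exact: klinear_conv.
- move=> a b; rewrite /conv sw_mul; last by klin.
  rewrite (sw_out a _ (klinear_mull _ (@klinear_id _ _))); apply: eq_sw => x y.
  rewrite (sw_out b _ (klinear_mulr _ (@klinear_id _ _))); apply: eq_sw => z t.
  by rewrite fM gM -!mulrA [f z * (_ * _)]mulrA fg !mulrA.
- by rewrite /conv sw_one ?f1 ?g1 ?mulr1 //; klin.
Qed.

Lemma comp_alg_map R R' R'' (f : R' -> R'') (g : R -> R') :
  alg_map f -> alg_map g -> alg_map (f \o g).
Proof.
move=> [lf fM f1] [lg gM g1]; split=> [c x y|x y|] /=; first by rewrite lg lf.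
  by rewrite gM fM.
by rewrite g1 f1.
Qed.

Lemma ap_alg_map A R (f : A -> R) : alg_map f -> (forall x y, f x * f y = f y * f x) ->
  alg_map (f \o ap A).
Proof.
move=> af fC; have [lf fM f1] := af; split=> [|x y|] /=.
- exact: (klinear_comp lf (@ap_klinear _ A)).
- by rewrite apM fM fC.
- by rewrite ap1.
Qed.

Lemma bilin_functionals (U V U' V' : lmodType k) (u : U' -> k) (v : V' -> k)
    (f : U -> U') (g : V -> V') : lin_fun u -> lin_fun v -> klinear f -> klinear g ->
  bilin (fun x y => u (f x) * v (g y) : k^o).
Proof.
move=> lu lv lf lg; split=> [y c x z|y c x z] /=; first by rewrite lf lu mulrDl -mulrA.
by rewrite lg lv mulrDr mulrCA.
Qed.

Lemma comp_hopf_map A B C (f : B -> C) (g : A -> B) :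
  hopf_map f -> hopf_map g -> hopf_map (f \o g).
Proof.
move=> hf hg; have [af fD fe] := hf; have [ag gD ge] := hg; split.
- exact: comp_alg_map.
- move=> a u v lu lv; rewrite /= (fD (g a) u v lu lv) !big_map /=.
  have bh := bilin_functionals lu lv (hopf_klinear hf) (hopf_klinear hf).
  by have := teq_bilin (gD a) bh; rewrite big_map.
- by move=> a; rewrite /= fe ge.
Qed.

Lemma hopf_map_factor A B C (q : A -> B) (f : A -> C) (h : B -> C) :
  hopf_map q -> surjective q -> hopf_map f -> (forall a, h (q a) = f a) -> hopf_map h.
Proof.
move=> hq sq hf hqf; have [[lq qM q1] qD qe] := hq; have [[lf fM f1] fD fe] := hf.
have lh : klinear h.
  by move=> c x y; have [a <-] := sq x; have [b <-] := sq y; rewrite -lq !hqf lf.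
split.
- split=> [//|x y|]; last by rewrite -q1 hqf f1.
  by have [a <-] := sq x; have [b <-] := sq y; rewrite -qM !hqf fM.
- move=> x; have [a <-] := sq x; move=> u v lu lv; rewrite hqf (fD a u v lu lv) !big_map /=.
  have bh := bilin_functionals lu lv lh lh.
  have := teq_bilin (qD a) bh; rewrite big_map /= => ->.
  by apply: eq_bigr => p _; rewrite !hqf.
- by move=> x; have [a <-] := sq x; rewrite hqf fe qe.
Qed.

Lemma hopf_map_id A : hopf_map (fun x : A => x).
Proof.
split=> // x; under eq_map => p do rewrite -surjective_pairing.
by rewrite map_id.
Qed.

Lemma hopf_iso_inv A B (f : A -> B) : hopf_iso f ->
  exists g, [/\ hopf_iso g, cancel f g & cancel g f].
Proof.
move=> [hf [g fK gK]]; exists g; split => //; split; last by exists f.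
by apply: (hopf_map_factor hf _ (hopf_map_id A) fK) => y; exists (g y).
Qed.

Lemma factor_ker (U V W : lmodType k) (q : U -> V) (f : U -> W) :
  klinear q -> klinear f -> surjective q -> (forall x, q x = 0 -> f x = 0) ->
  exists h : V -> W, forall x, h (q x) = f x.
Proof.
move=> lq lf sq kqf; have [l lP] := choice sq; exists (f \o l) => x /=.
apply/eqP; rewrite -subr_eq0 -(klinearB lf); apply/eqP/kqf.
by rewrite (klinearB lq) lP subrr.
Qed.

Lemma alg_map_factor R R' R'' (q : R -> R') (f : R -> R'') (h : R' -> R'') :
  alg_map q -> surjective q -> alg_map f -> (forall a, h (q a) = f a) -> alg_map h.
Proof.
move=> [lq qM q1] sq [lf fM f1] hqf; split=> [c x y|x y|]; last by rewrite -q1 hqf f1.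
  by have [a <-] := sq x; have [b <-] := sq y; rewrite -lq !hqf lf.
by have [a <-] := sq x; have [b <-] := sq y; rewrite -qM !hqf fM.
Qed.

End Antipode.

(** * Noetherian rings *)

Section Noetherian.
Variables (k : fieldType) (A : algType k).

(** The operation [*:] on columns multiplies on the left; the right action of [A] is a product with
    a 1 by 1 scalar matrix. *)
Definition right_submod n (I : 'cV[A]_n -> Prop) : Prop :=
  [/\ I 0, forall x y, I x -> I y -> I (x + y) & forall a x, I x -> I (x *m a%:M)].

Lemma chain_mono T (I : nat -> T -> Prop) : (forall n x, I n x -> I n.+1 x) ->
  forall n m x, (n <= m)%N -> I n x -> I m x.
Proof.
move=> Imono n m x /subnK <-; elim: (m - n)%N => // l IH Inx.
by rewrite addSn; apply: Imono; exact: IH.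
Qed.

(** Induction on [n]: [J] collects the first coordinates of a submodule and [K] its vectors with
    first coordinate 0. Once both chains are stationary, subtracting a vector with the same first
    coordinate shows that the submodules are. *)
Lemma acc_right_submod n : acc_on (@right_ideal k A) -> acc_on (@right_submod n).
Proof.
move=> accA; elim: n => [|n IH] I Isub Imono.
  by exists 0%N => m _ x; rewrite [x]flatmx0; split=> _; case: (Isub 0%N); case: (Isub m).
pose J l a := exists y : 'cV[A]_n, I l (col_mx (a%:M : 'M_1) y : 'cV_(1 + n)).
pose K l (y : 'cV[A]_n) := I l (col_mx (0 : 'M_1) y : 'cV_(1 + n)).
have [||n1 Jn1] := accA J.
- move=> l; have [I0 ID IM] := Isub l; split.
  + by exists 0; rewrite raddf0 col_mx0.
  + move=> x y [u Iu] [v Iv]; exists (u + v).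
    by rewrite raddfD -add_col_mx; exact: ID.
  + move=> a x [u Iu]; exists (u *m a%:M).
    by rewrite scalar_mxM -mul_col_mx; exact: IM.
- by move=> l a [y Iy]; exists y; exact: Imono.
have [||n2 Kn2] := IH K.
- move=> l; have [I0 ID IM] := Isub l; split; rewrite /K.
  + by rewrite col_mx0.
  + by move=> x y Ix Iy; rewrite -[0]addr0 -add_col_mx; exact: ID.
  + by move=> a x Ix; rewrite -[0](mul0mx _ a%:M) -mul_col_mx; exact: IM.
- by move=> l y Iy; exact: Imono.
exists (maxn n1 n2) => m; rewrite geq_max => /andP[n1m n2m] x.
split; last by apply: (chain_mono Imono); rewrite geq_max n1m.
have [a [y ->]] : exists a y, x = col_mx (a%:M : 'M_1) (y : 'cV[A]_n) :> 'cV_(1 + n).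
  exists ((@usubmx _ 1 n 1 x) 0 0), (@dsubmx _ 1 n 1 x).
  by rewrite -mx11_scalar vsubmxK.
move=> Ix.
have [y' Iy'] : J n1 a by apply/(Jn1 m n1m); exists y.
have Iy'm := chain_mono Imono (leq_maxl n1 n2) Iy'.
have [_ ID IM] := Isub m; have [_ ID' _] := Isub (maxn n1 n2).
have /(Kn2 m n2m) Kd : K m (y - y').
  rewrite /K -[0](subrr (a%:M : 'M_1)) -add_col_mx -opp_col_mx; apply: ID => //.
  by have := IM (-1) _ (chain_mono Imono n1m Iy'); rewrite raddfN mulmxN mulmx1.
rewrite -[a%:M]addr0 -[y](subrK y') [y - y' + _]addrC -add_col_mx; apply: ID' => //.
exact: (chain_mono Imono (leq_maxr n1 n2) Kd).
Qed.

(* A surjective endomorphism of a noetherian module is injective; here surjectivity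
   holds only after inverting the central element [s], so injectivity does too. *)
Lemma noetherian_right_inverse n (W Y : 'M[A]_n) (s : A) :
  acc_on (@right_ideal k A) -> (forall a, s * a = a * s) -> W *m Y = s%:M ->
  exists N, forall y : 'cV[A]_n, W *m y = 0 -> s ^+ N *: y = 0.
Proof.
move=> accA sC WY.
pose I l (y : 'cV[A]_n) := iter l (mulmx W) y = 0.
have itM l m (y : 'cV[A]_n) (z : 'M[A]_(1, m)) :
    iter l (mulmx W) (y *m z) = iter l (mulmx W) y *m z.
  by elim: l => //= l ->; rewrite mulmxA.
have it0 l : iter l (mulmx W) (0 : 'cV_n) = 0.
  by elim: l => //= l ->; rewrite mulmx0.
have itD l (x y : 'cV[A]_n) :
    iter l (mulmx W) (x + y) = iter l (mulmx W) x + iter l (mulmx W) y.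
  by elim: l => //= l ->; rewrite mulmxDr.
have [||N NP] := acc_right_submod accA (I := I).
- move=> l; rewrite /I; split=> // [x y|a x]; first by rewrite itD => -> ->; rewrite addr0.
  by rewrite itM => ->; rewrite mul0mx.
- by move=> l y Iy; rewrite /I /= Iy mulmx0.
have sW (y : 'cV[A]_n) : W *m (s *: y) = s *: (W *m y).
  apply/matrixP => a b; rewrite !mxE mulr_sumr; apply: eq_bigr => l _.
  by rewrite mxE !mulrA sC.
have itZ l (y : 'cV[A]_n) : iter l (mulmx W) (s *: y) = s *: iter l (mulmx W) y.
  by elim: l => //= l ->; rewrite sW.
have WYl l (y : 'cV[A]_n) : iter l (mulmx W) (iter l (mulmx Y) y) = s ^+ l *: y.
  elim: l y => [|l IH] y; first by rewrite expr0 scale1r.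
  by rewrite iterSr /= mulmxA WY mul_scalar_mx itZ IH scalerA -exprS.
(* Since W^(N+1) Y^N y = s^N W y = 0 and the kernels of the powers of [W] are stationary from [N]
   on, W^N Y^N y = s^N y is zero. *)
exists N => y Wy; rewrite -WYl; apply/(NP N.+1 (leqnSn N)); rewrite /I /= WYl.
have sWl l : W *m (s ^+ l *: y) = s ^+ l *: (W *m y).
  by elim: l => [|l IH]; rewrite ?expr0 ?scale1r // exprS -!scalerA sW IH.
by rewrite sWl Wy scaler0.
Qed.

End Noetherian.

(** * Finitely generated relative Hopf modules *)

Section Comodules.
Variables (k : fieldType) (A : hopf k).

(** The comultiplication of [a] has a representative with first legs in [P]; when [P] is a subspace,
    this says that it lies in P (x) A. *)
Definition coact (P : A -> Prop) (a : A) : Prop :=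
  exists2 s, teq s (cm A a) & forall p, p \in s -> P p.1.

Lemma coactW (P Q : A -> Prop) a : (forall x, P x -> Q x) -> coact P a -> coact Q a.
Proof. by move=> PQ [s sa sP]; exists s => // p /sP /PQ. Qed.

(** Write Delta(a) as a sum of x_l (x) w_l with independent w_l. Coassociativity, with the
    functional dual to w_t on the last leg, gives Delta(x_t) as a sum of x_l (x) c_l, so the x_l
    span a subcomodule; the counit recovers [a]. *)
Lemma locally_finite (a : A) : exists vs : seq A,
  (forall x, x \in vs -> coact (fun y => y \in vs) x) /\ exists c, a = lcomb vs c.
Proof.
have [w [x [iw wP]]] := tensor_reduce (cm A a).
have swE (W : lmodType k) (f : A -> A -> W) : bilin f ->
    sw a f = \sum_(l < size w) f (x l) w`_l by move=> /wP.
exists (mkseq x (size w)); split; last first.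
  exists (fun l => cu A w`_l); rewrite -[LHS](counit_r (hopfP A) a).
  rewrite -/(sw a (fun x y => cu A y *: x)) swE /lcomb; last by klin.
  by rewrite size_mkseq; apply: eq_bigr => l _; rewrite nth_mkseq.
move=> v /mapP[t]; rewrite mem_iota /= add0n => tw -> {v}.
have [g [lg _ gw]] := dual_functional (subspace_eq0 A) iw tw.
pose c l := sw w`_l (fun y z => g z *: y).
exists [seq (x l, c l) | l <- iota 0 (size w)] => [u v lu lv|p]; last first.
  by move=> /mapP[l lw ->] /=; apply: map_f.
pose F x y z : k^o := u x * (v y * g z).
have tF : trilin F.
  split=> y z d p q; rewrite /F.
  - by rewrite lu mulrDl -mulrA.
  - by rewrite lv mulrDl mulrDr -[d *: _]/(d * _) !mulrA [u y * d]mulrC.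
  - by rewrite lg !mulrDr -[d *: _]/(d * _) !mulrA [d * u y]mulrC -!mulrA [d * (v z * _)]mulrCA.
have [F1 F2 F3] := tF.
have := swA a tF; rewrite !swE; last 2 first.
- split=> [y|z]; first by apply: klinear_sw => p q; exact: F1.
  by apply: sw_klinear; split=> p; [exact: F2|exact: F3].
- split=> [z|p]; last by apply: klinear_sw => ? ?; exact: F3.
  by apply: sw_klinear; split=> p; [exact: F1|exact: F2].
rewrite (bigD1 (Ordinal tw)) //= big1 ?addr0 => [e|l lt]; last first.
  rewrite /sw big1 // => p _; rewrite /F gw //.
  by move: lt; rewrite -val_eqE /= => /negbTE ->; rewrite !mulr0.
rewrite big_map -[X in iota 0 X]subn0 -/(index_iota _ _) big_mkord /=.
transitivity (\sum_(l < size w) sw w`_l (fun y z => F (x l) y z)).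
  apply: eq_bigr => l _; rewrite /c /sw /F -mulr_sumr; congr (_ * _).
  rewrite (klinear_sum (V := k^o) lv); apply: eq_bigr => p _.
  by rewrite lin_funZ // mulrC.
by rewrite -e; apply: eq_bigr => p _; rewrite /F gw // eqxx mulr1.
Qed.

Lemma finite_subcomodule (L : seq A) : exists vs : seq A,
  [/\ 1 \in vs, forall x, x \in vs -> coact (fun y => y \in vs) x
    & forall x, x \in L -> exists c, x = lcomb vs c].
Proof.
elim: L => [|a L [vs [vs1 vsC vsL]]].
  exists [:: 1]; split=> [|x|//]; first exact: mem_head.
  rewrite inE => /eqP ->.
  exists [:: (1, 1)] => [u v lu lv|p]; first by rewrite (cm_one (hopfP A)).
  by rewrite inE => /eqP -> /=; exact: mem_head.
have [ws [wsC [c ac]]] := locally_finite a; exists (vs ++ ws); split.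
- by rewrite mem_cat vs1.
- move=> x; rewrite mem_cat => /orP[/vsC|/wsC].
    by apply: coactW => y yv; rewrite mem_cat yv.
  by apply: coactW => y yv; rewrite mem_cat yv orbT.
move=> x; rewrite inE => /orP[/eqP ->|/vsL [d ->]]; rewrite /lcomb size_cat.
  exists (fun l => if (l < size vs)%N then 0 else c (l - size vs)%N).
  rewrite big_split_ord /= big1 ?add0r => [|l _]; last by rewrite ltn_ord scale0r.
  rewrite {1}ac; apply: eq_bigr => l _.
  by rewrite ltnNge leq_addr /= addKn nth_cat ltnNge leq_addr /= addKn.
exists (fun l => if (l < size vs)%N then d l else 0).
rewrite big_split_ord /= [X in _ = _ + X]big1 ?addr0 => [|l _]; last first.
  by rewrite ltnNge leq_addr scale0r.
by apply: eq_bigr => l _; rewrite ltn_ord nth_cat ltn_ord.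
Qed.

End Comodules.

(** * Spans over a central Hopf subalgebra, and Nakayama's lemma at the augmentation ideal *)

Section CentralSubalgebra.
Variables (k : fieldType) (B A : hopf k) (i : B -> A).
Hypotheses (hi : hopf_map i) (ii : injective i).
Hypothesis iC : forall (b : B) (a : A), i b * a = a * i b.

Let li : klinear i := hopf_klinear hi.
Let iM x y : i (x * y) = i x * i y. Proof. by case: hi => -[]. Qed.
Let i1 : i 1 = 1. Proof. by case: hi => -[]. Qed.

Lemma central_subalg_comm (b c : B) : b * c = c * b.
Proof. by apply: ii; rewrite !iM iC. Qed.

(** This is the module generated by [vs] when [I] is everything, and B^+ times that module when [I]
    is the augmentation ideal. *)
Definition bspan (I : B -> Prop) (vs : seq A) (x : A) : Prop :=
  exists2 s : seq (B * A), forall p, p \in s -> I p.1 /\ p.2 \in vs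
    & x = \sum_(p <- s) i p.1 * p.2.

Definition ideal_like (I : B -> Prop) : Prop :=
  subspace I /\ forall b x, I x -> I (b * x).

Lemma ideal_like_aug : ideal_like (fun b => cu B b = 0).
Proof.
have lcu := @cu_lin_fun _ B.
split=> [|b x x0]; last by rewrite (cu_mul (hopfP B)) x0 mulr0.
split; first exact: (klinear0 (V := k^o) lcu).
by move=> c x y x0 y0; rewrite lcu x0 y0 mulr0 addr0.
Qed.

Lemma ideal_like_True : ideal_like (fun=> True).
Proof. by []. Qed.

Section Bspan.
Variables (I : B -> Prop) (idI : ideal_like I).

Lemma bspan0 vs : bspan I vs 0.
Proof. by exists [::]; rewrite ?big_nil. Qed.

Lemma bspanD vs x y : bspan I vs x -> bspan I vs y -> bspan I vs (x + y).
Proof.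
move=> [s sI ->] [t tI ->]; exists (s ++ t); last by rewrite big_cat.
by move=> p; rewrite mem_cat => /orP[/sI|/tI].
Qed.

Lemma bspanM vs b x : bspan I vs x -> bspan I vs (i b * x).
Proof.
move=> [s sI ->]; exists [seq (b * p.1, p.2) | p <- s].
  by move=> _ /mapP[p /sI [Ip pv] ->]; split => //; exact: idI.2.
by rewrite big_map mulr_sumr; apply: eq_bigr => p _; rewrite iM mulrA.
Qed.

Lemma bspan_subspace vs : subspace (bspan I vs).
Proof.
split; first exact: bspan0.
move=> c x y sx sy; apply: bspanD => //.
have -> : c *: x = i c%:A * x by rewrite (klinearZ li) i1 mulr_algl.
exact: bspanM.
Qed.

Lemma bspan_gen vs b x : I b -> x \in vs -> bspan I vs (i b * x).
Proof.
move=> Ib xv; exists [:: (b, x)]; last by rewrite big_seq1.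
by move=> p; rewrite inE => /eqP ->.
Qed.

Lemma bspan_cons y vs x : bspan I (y :: vs) x ->
  exists b x', [/\ I b, bspan I vs x' & x = i b * y + x'].
Proof.
move=> [s sI ->]; elim: s sI => [_|p s IH sI].
  exists 0, 0; rewrite big_nil (klinear0 li) mul0r addr0; split=> //; last exact: bspan0.
  exact: idI.1.1.
have [|b [x' [Ib sx' e]]] := IH; first by move=> q qs; apply: sI; rewrite inE qs orbT.
rewrite big_cons e; have [Ip] := sI p (mem_head _ _).
rewrite inE => /orP[/eqP ->|pv].
  exists (p.1 + b), x'; split=> //; first exact: subspaceD idI.1 _ _ Ip Ib.
  by rewrite (klinearD li) mulrDl addrA.
exists b, (i p.1 * p.2 + x'); split=> //; first exact: bspanD (bspan_gen _ _) _.
by rewrite addrCA.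
Qed.

End Bspan.

Definition bmodule (M : A -> Prop) : Prop :=
  subspace M /\ forall b m, M m -> M (i b * m).

Lemma bmodule_bspan vs : bmodule (bspan (fun=> True) vs).
Proof.
split; first exact: (bspan_subspace ideal_like_True).
by move=> b m; exact: (bspanM ideal_like_True).
Qed.

(* Eliminating the generators one at a time avoids determinants over [B]. *)
Lemma nakayama_aug (N : A -> Prop) (vs : seq A) : bmodule N ->
  (forall x, x \in vs -> exists2 n, N n & bspan (fun b => cu B b = 0) vs (x - n)) ->
  exists2 s, cu B s = 1 & forall x, x \in vs -> N (i s * x).
Proof.
move=> [sN NM]; have idI := ideal_like_aug.
elim: vs => [|y vs IH] vsN; first by exists 1; rewrite ?(cu_one (hopfP B)).
have [n Nn /(bspan_cons idI)[x0 [z [x00 sz e]]]] := vsN y (mem_head _ _).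
(* The congruence for [y] reads y = n + x0 y + z with x0 in B^+, so (1 - x0) y lies in [N] plus B^+
   times the remaining generators. *)
have cux0 : cu B (1 - x0) = 1.
  by rewrite (klinearB (V := k^o) (@cu_lin_fun _ B)) x00 (cu_one (hopfP B)) subr0.
have ey : i (1 - x0) * y = n + z.
  rewrite (klinearB li) i1 mulrBl mul1r; apply/eqP; rewrite subr_eq.
  by move/eqP: e; rewrite subr_eq -addrA addrC [z + n]addrC.
have [|s cus sN'] := IH.
  move=> x xv; have [|m Nm /(bspan_cons idI)[b [t [b0 st ex]]]] := vsN x.
    by rewrite inE xv orbT.
  (* When x = m + b y + t is multiplied by 1 - x0, the term in [y] becomes b (n + z); what is left
     over, together with x0 x, has coefficients in B^+ and no [y]. *)
  exists (i (1 - x0) * m + i b * n); first by apply: (subspaceD sN); exact: NM.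
  have -> : x - (i (1 - x0) * m + i b * n) =
      i x0 * x + (i (1 - x0) * t + i b * z).
    have -> : i (1 - x0) * t = i (1 - x0) * (x - m) - i b * (n + z).
      rewrite ex mulrDr -ey [_ * (i b * y)]mulrA -iM central_subalg_comm iM -mulrA.
      by rewrite [_ + i _ * t]addrC addrK.
    rewrite [i b * (n + z)]mulrDr mulrBr !opprD !addrA subrK; congr (_ - _ - _).
    by rewrite -mulrDl -(klinearD li) addrC subrK i1 mul1r.
  apply: bspanD; first exact: bspan_gen.
  by apply: bspanD; apply: bspanM.
exists (s * (1 - x0)); first by rewrite (cu_mul (hopfP B)) cus cux0 mulr1.
have sb b x : N (i s * x) -> N (i s * (i b * x)).
  by rewrite mulrA [i s * i b]iC -mulrA; exact: NM.
move=> x; rewrite inE iM -mulrA => /orP[/eqP ->|/sN']; last exact: sb.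
rewrite ey mulrDr; apply: (subspaceD sN); first exact: NM.
have [r rP ->] := sz; rewrite mulr_sumr; apply: (subspace_sum sN) => p /rP [_ pv].
exact/sb/sN'.
Qed.

End CentralSubalgebra.

(** * The retraction onto a central Hopf subalgebra *)

Section Retraction.
Variables (k : fieldType) (B A : hopf k) (i : B -> A).
Hypotheses (hi : hopf_map i) (ii : injective i).
Hypothesis iC : forall (b : B) (a : A), i b * a = a * i b.
Hypothesis accA : acc_on (@right_ideal k A).

Let li : klinear i := hopf_klinear hi.
Let iM x y : i (x * y) = i x * i y. Proof. by case: hi => -[]. Qed.
Let i1 : i 1 = 1. Proof. by case: hi => -[]. Qed.
Let cui b : cu A (i b) = cu B b. Proof. by case: hi. Qed.

Definition hopf_submodule (M : A -> Prop) : Prop :=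
  [/\ bmodule i M, M 1 & forall m, M m -> coact M m].

Lemma coact_bspan vs :
  (forall x, x \in vs -> coact (fun y => y \in vs) x) ->
  forall m, bspan i (fun=> True) vs m -> coact (bspan i (fun=> True) vs) m.
Proof.
move=> vsC _ [s sv ->]; set M := bspan _ _ _.
have [sM MM] : bmodule i M := bmodule_bspan hi vs.
have bh u v : lin_fun u -> lin_fun v -> bilin (fun x y : A => u x * v y : k^o).
  by move=> lu lv; apply: bilin_functionals.
elim: s sv => [_|p s IH sv].
  exists [::] => // u v lu lv; rewrite !big_nil.
  by have := klinear0 (sw_klinear (bh u v lu lv)); rewrite /sw.
have [|t tE tM] := IH; first by move=> q qs; apply: sv; rewrite inE qs orbT.
have [_ /vsC [r rE rM]] := sv p (mem_head _ _).
exists (flatten [seq [seq (i q.1 * x.1, i q.2 * x.2) | x <- r] | q <- cm B p.1] ++ t).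
  move=> u v lu lv; have buv := bh u v lu lv; rewrite big_cat big_cons.
  have := klinearD (sw_klinear buv) (i p.1 * p.2) (\sum_(q <- s) i q.1 * q.2).
  rewrite {1}/sw => ->; rewrite (tE u v lu lv); congr (_ + _).
  rewrite sw_mul // (sw_map _ hi); last first.
    split=> [y|x]; apply: klinear_sw => z z'.
      exact: (klinear_comp (bilin_l buv (y * z')) (klinear_mull z (@klinear_id _ _))).
    exact: (klinear_comp (bilin_r buv (x * z)) (klinear_mull z' (@klinear_id _ _))).
  rewrite big_flatten big_map; apply: eq_bigr => q _; rewrite big_map.
  rewrite (sw_teq rE) //; split=> y.
    exact: (klinear_comp (bilin_l buv (i q.2 * y)) (klinear_mulr _ (@klinear_id _ _))).
  exact: (klinear_comp (bilin_r buv (i q.1 * y)) (klinear_mulr _ (@klinear_id _ _))).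
move=> q; rewrite mem_cat => /orP[/flattenP[l /mapP[x xB ->] /mapP[y yr ->]]|/tM//] /=.
by apply: bspan_gen => //; exact: rM.
Qed.

Lemma retraction_near_unit (L : seq A) : exists (M : A -> Prop) (r : A -> B),
  [/\ hopf_submodule M, forall x, x \in L -> M x, klinear r, cu B (r 1) = 1
    & forall b m, M m -> r (i b * m) = b * r m].
Proof.
have bC := central_subalg_comm hi ii iC.
have [vs [vs1 vsC vsL]] := finite_subcomodule L.
pose aug (b : B) := cu B b = 0; have idI : ideal_like aug := @ideal_like_aug _ _.
pose P := bspan i aug vs; pose M := bspan i (fun=> True) vs.
have bM : bmodule i M := bmodule_bspan hi vs.
have [sM MM] := bM.
have Mvs x : x \in vs -> M x by rewrite -{2}[x]mul1r -i1 => xv; apply: bspan_gen.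
have hM : hopf_submodule M by split=> //; [exact: Mvs | exact: coact_bspan].
have sP : subspace P := bspan_subspace hi idI vs.
have augM b m : aug b -> M m -> P (i b * m).
  move=> b0 [s sv ->]; exists [seq (b * p.1, p.2) | p <- s].
    by move=> _ /mapP[p /sv [_ pv] ->]; split => //=; rewrite /aug (cu_mul (hopfP B)) b0 mul0r.
  by rewrite big_map mulr_sumr; apply: eq_bigr => p _; rewrite iM mulrA.
(* The counit vanishes on B^+ M, so 1 survives in M / B^+ M and may head the basis. *)
have nP1 : ~ P 1.
  move=> [s sv e]; have := cu_one (hopfP A); rewrite e.
  rewrite (klinear_sum (V := k^o) (@cu_lin_fun _ A)) big_seq big1 => [/esym/eqP|p /sv [p0 _]].
    by rewrite oner_eq0.
  by rewrite (cu_mul (hopfP A)) cui p0 mul0r.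
have i11 : indep_mod P [:: 1].
  move=> c; rewrite /lcomb big_ord_recl big_ord0 /= addr0 => Pc [] //= _.
  apply: contrapT => /eqP c0; apply: nP1.
  by have := subspaceZ sP (c 0%N)^-1 Pc; rewrite scalerA mulVf // scale1r.
have [w' [iw w'vs wvs]] := indep_mod_extend sP i11 vs.
pose w := [:: 1] ++ w'; pose n := size w.
have wv l : (l < n)%N -> w`_l \in vs.
  by case: l => [|l] lw; [exact: vs1 | exact/w'vs/mem_nth].
pose N x := exists b : nat -> B, x = \sum_(l < n) i (b l) * w`_l.
have bN : bmodule i N.
  split; first split.
  - by exists (fun=> 0); rewrite big1 // => l _; rewrite (klinear0 li) mul0r.
  - move=> c _ _ [b ->] [d ->]; exists (fun l => c *: b l + d l).
    rewrite scaler_sumr -big_split; apply: eq_bigr => l _ /=.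
    by rewrite li mulrDl scalerAl.
  - move=> b _ [d ->]; exists (fun l => b * d l); rewrite mulr_sumr.
    by apply: eq_bigr => l _; rewrite iM mulrA.
have [|s cus sN] := nakayama_aug hi ii iC (N := N) (vs := vs) bN.
  move=> x /wvs [c Pc]; exists (lcomb w c) => //; exists (fun l => (c l)%:A).
  by apply: eq_bigr => l _; rewrite (alg_map_scalar _ (hopf_alg hi)) mulr_algl.
have sNM m : M m -> N (i s * m).
  move=> [t tv ->]; rewrite mulr_sumr; apply: (subspace_sum bN.1) => p /tv [_ pv].
  by rewrite mulrA [i s * _]iC -mulrA; apply: bN.2; exact: sN.
have [D DP] : {D : A -> nat -> B &
    forall m, M m -> i s * m = \sum_(l < n) i (D m l) * w`_l}.
  apply: (@choice _ _ (fun m (d : nat -> B) => M m -> i s * m = \sum_(l < n) i (d l) * w`_l)) => m.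
  by have [/sNM [d dP]|nm] := pselect (M m); [exists d | exists (fun=> 0)].
have [phi phiP] : {phi : nat -> A -> k & forall j, (j < n)%N ->
    [/\ lin_fun (phi j), forall x, P x -> phi j x = 0
      & forall l, (l < n)%N -> phi j w`_l = (l == j)%:R]}.
  apply: (@choice _ _ (fun j f => (j < n)%N -> [/\ lin_fun f, forall x, P x -> f x = 0
      & forall l, (l < n)%N -> f w`_l = (l == j)%:R])) => j.
  have [jn|_] := boolP (j < n)%N; last by exists (fun=> 0).
  by have [f] := dual_functional sP iw jn; exists f.
(* [T j] is the [j]-th coordinate of the map M -> (M / B^+ M) (x) A induced by the comultiplication;
   it is B-linear because [phi j] vanishes on B^+ M. *)
pose T j m : A := sw m (fun x y => phi j x *: y).
have TM j b m : (j < n)%N -> M m -> T j (i b * m) = i b * T j m.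
  move=> jn Mm; have [lphi phiP0 _] := phiP j jn.
  have [_ _ MC] := hM; have [t tE tM] := MC m Mm.
  rewrite /T sw_mul; last by klin.
  rewrite (sw_map _ hi); last by klin.
  rewrite (sw_out m _ (klinear_mulr _ (@klinear_id _ A))).
  under eq_sw => b1 b2 do (rewrite (sw_teq tE); last by klin).
  rewrite [RHS](sw_teq tE) => [|]; last by klin.
  rewrite sw_sum !big_seq; apply: eq_bigr => p /tM Mp.
  transitivity (sw b (fun b1 b2 => cu B b1 *: (phi j p.1 *: (i b2 * p.2)))).
    apply: eq_sw => b1 b2; rewrite scalerA; congr (_ *: _).
    have -> : i b1 * p.1 = cu B b1 *: p.1 + i (b1 - (cu B b1)%:A) * p.1.
      by rewrite (klinearB li) (alg_map_scalar _ (hopf_alg hi)) mulrBl mulr_algl addrC subrK.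
    rewrite lphi [X in _ + X]phiP0 ?addr0 //; apply: augM => //.
    rewrite /aug (klinearB (V := k^o) (@cu_lin_fun _ B)).
    by rewrite (lin_funZ (@cu_lin_fun _ B)) (cu_one (hopfP B)) mulr1 subrr.
  by rewrite (sw_counitl b (f := fun b2 => phi j p.1 *: (i b2 * p.2))) ?scalerAr //; klin.
have [sl slP] : {sl : nat -> seq (A * A) & forall l, (l < n)%N ->
    teq (sl l) (cm A w`_l) /\ forall p, p \in sl l -> M p.1}.
  apply: (@choice _ _ (fun l t => (l < n)%N ->
    teq t (cm A w`_l) /\ forall p, p \in t -> M p.1)) => l.
  have [ln|_] := boolP (l < n)%N; last by exists [::].
  by have [_ _ MC] := hM; have [t tE tM] := MC _ (Mvs _ (wv _ ln)); exists t.
(* [W] lists the coordinates of the w_j. Column [l] of [Y] expands s w_l(1) in the w_j and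
   multiplies by S w_l(2), so W Y computes s phi(w_l(1)) w_l(2) S w_l(3), which is [s] times the
   identity. *)
pose W : 'M[A]_n := \matrix_(l, j) T l w`_j.
pose Y : 'M[A]_n := \matrix_(j, l) \sum_(p <- sl l) i (D p.1 j) * ap A p.2.
have WY : W *m Y = (i s)%:M.
  apply/matrixP => l' l; rewrite !mxE.
  have [lphi _ phiw] := phiP l' (ltn_ord _); have [tE tM] := slP l (ltn_ord _).
  have lT : klinear (T l') by rewrite /T; klin.
  transitivity (i s * sw w`_l (fun x y => T l' x * ap A y)).
    rewrite (sw_teq tE) => [|]; last by klin.
    rewrite mulr_sumr; under eq_bigr => j _ do rewrite !mxE mulr_sumr.
    rewrite exchange_big /= !big_seq; apply: eq_bigr => p /tM Mp.
    rewrite mulrA -TM // DP // (klinear_sum lT) mulr_suml; apply: eq_bigr => j _.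
    rewrite TM //; last exact: (Mvs _ (wv _ (ltn_ord _))).
    by rewrite !mulrA iC.
  have -> : sw w`_l (fun x y => T l' x * ap A y) = phi l' w`_l *: 1.
    rewrite /T; under eq_sw => x y do
      rewrite (sw_out _ _ (klinear_mull _ (@klinear_id _ _))).
    rewrite (swA _ (f := fun x1 x2 y => phi l' x1 *: x2 * ap A y)); last by klin.
    under eq_sw => x y do under eq_sw => y' z do rewrite -scalerAl.
    by rewrite (sw_apr_tail _ (f := fun x z => phi l' x *: z)) //; klin.
  by rewrite phiw // mulr_algr -val_eqE /= eq_sym scaler_nat.
have [e eP] := noetherian_right_inverse accA (iC s) WY.
have n0 : (0 < n)%N by [].
have iX x m : i (x ^+ m) = i x ^+ m.
  by elim: m => [|m IH]; rewrite ?expr0 // !exprS iM IH.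
(* [r] takes the coefficient of w_0 = 1 in s x, multiplied by s^e. Two expansions differ by a
   relation whose coefficient vector is killed by [W], hence by s^e. *)
have [||r lr rP] := @linear_rel_extend k A B (fun x y => exists2 b : nat -> B,
  i s * x = \sum_(l < n) i (b l) * w`_l & y = s ^+ e * b 0%N).
- split.
    exists (fun=> 0); rewrite ?mulr0 // big1 // => l _.
    by rewrite (klinear0 li) mul0r.
  move=> c x y _ _ [b xb ->] [d yd ->]; exists (fun l => c *: b l + d l).
    rewrite mulrDr -scalerAr xb yd scaler_sumr -big_split; apply: eq_bigr => l _ /=.
    by rewrite li mulrDl scalerAl.
  by rewrite mulrDr scalerAr.
- move=> _ [b + ->]; rewrite mulr0 => b0; apply: ii; rewrite (klinear0 li) iM iX.
  pose y : 'cV[A]_n := \col_j i (b j).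
  have /eP/matrixP/(_ (Ordinal n0) 0) : W *m y = 0; last by rewrite !mxE.
  apply/matrixP => l z; rewrite !mxE.
  have [lphi _ _] := phiP l (ltn_ord _).
  have lT : klinear (T l) by rewrite /T; klin.
  have := congr1 (T l) b0; rewrite (klinear0 lT) (klinear_sum lT) => b0'; rewrite [RHS]b0'.
  apply: eq_bigr => j _; rewrite !mxE TM //; exact: (Mvs _ (wv _ (ltn_ord _))).
exists M, r; split=> //.
- move=> x /vsL [c ->]; apply: (subspace_sum sM) => l _.
  by apply: (subspaceZ sM); apply: Mvs; exact: mem_nth.
- have -> : r 1 = s ^+ e * s.
    apply: rP; exists (fun l => if l is 0%N then s else 0) => //.
    by rewrite /n /= big_ord_recl /= big1 ?addr0 // => l _; rewrite (klinear0 li) mul0r.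
  rewrite -exprSr; elim: (e.+1) => [|m IH]; first by rewrite expr0 (cu_one (hopfP B)).
  by rewrite exprS (cu_mul (hopfP B)) IH cus mulr1.
- move=> b m Mm; have -> : r m = s ^+ e * D m 0%N by apply: rP; exists (D m); rewrite ?DP.
  apply: rP; exists (fun l => b * D m l); last by rewrite !mulrA [b * _]bC.
  rewrite mulrA [i s * i b]iC -mulrA DP // mulr_sumr.
  by apply: eq_bigr => l _; rewrite iM mulrA.
Qed.
End Retraction.

(** * Unital retractions, contraction of extended ideals and descent of coinvariants *)

Section Descent.
Variables (k : fieldType) (B A : hopf k) (i : B -> A).
Hypotheses (hi : hopf_map i) (ii : injective i).
Hypothesis iC : forall (b : B) (a : A), i b * a = a * i b.
Hypothesis accA : acc_on (@right_ideal k A).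

Let li : klinear i := hopf_klinear hi.
Let iM x y : i (x * y) = i x * i y. Proof. by case: hi => -[]. Qed.
Let i1 : i 1 = 1. Proof. by case: hi => -[]. Qed.

(* The values [r 1] of the [B]-linear maps [r : M -> B] form a coideal of [B], because
   [r] can be translated by the coaction; hence [cu (r 1) = 1] can be improved to
   [r 1 = 1] by applying the antipode. *)
Lemma hopf_retraction (L : seq A) : exists (M : A -> Prop) (r : A -> B),
  [/\ hopf_submodule i M, forall x, x \in L -> M x, klinear r, r 1 = 1
    & forall b m, M m -> r (i b * m) = b * r m].
Proof.
have [M [r [hM LM lr r1 rM]]] := retraction_near_unit hi ii iC accA L.
have [f lf fi] := klinear_extend li ii (@ap_klinear k B).
(* At 1 this gives v_(1) S(v_(2)) for v = r 1, that is, the counit of [v], which is 1. It is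
   B-linear because b_(1) (x) b_(2) S(b_(3)) collapses to b (x) 1. *)
exists M, (fun m => sw m (fun x y => sw (r x) (fun u v => u * f (i v * ap A y)))).
split=> //; first by klin.
  rewrite sw_one; last by klin.
  rewrite ap1; under eq_sw => u v do rewrite mulr1 fi.
  by rewrite (sw_apr _ (@klinear_id _ B)) r1 scale1r.
move=> b m Mm; have [_ _ /(_ m Mm) [t tE tM]] := hM.
rewrite sw_mul; last by klin.
rewrite (sw_map _ hi); last by klin.
under eq_sw => b1 b2 do (rewrite (sw_teq tE); last by klin).
rewrite [sw m _](sw_teq tE); last by klin.
rewrite sw_sum mulr_sumr !big_seq; apply: eq_bigr => p /tM Mp.
pose G c z := sw (r p.1) (fun u v => c * u * f (i v * ap A p.2 * i z)).
transitivity (sw b (fun b1 b2 => sw b1 (fun c c' => G c (c' * ap B b2)))).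
  apply: eq_sw => b1 b2; rewrite rM // sw_mul; last by klin.
  apply: eq_sw => c c'; apply: eq_sw => u v; congr (_ * f _).
  rewrite apM (ap_hopf_map _ hi) !iM -!mulrA iC -!mulrA; congr (_ * (_ * _)).
  by rewrite iC.
rewrite (swA b (f := fun c c' b2 => G c (c' * ap B b2))); last by rewrite /G; klin.
rewrite (sw_apr_tail b (f := G)); last by rewrite /G; klin.
rewrite /G /sw mulr_sumr; apply: eq_bigr => q _.
by rewrite i1 mulr1 mulrA.
Qed.

(** With J = Ker p, A J meets B only in J: a retraction defined on the first factors of [s] exhibits
    [b] as a sum of r(a_l) b_l, and [p] kills each b_l. *)
Lemma extended_ideal_contract (K : algType k) (p : B -> K) (b : B) (s : seq (A * B)) :
  alg_map p -> all (fun q => p q.2 == 0) s -> i b = \sum_(q <- s) q.1 * i q.2 -> p b = 0.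
Proof.
move=> [lp pM p1] /allP s0 e.
have [M [r [[[sM MM] M1 _] LM lr r1 rM]]] := hopf_retraction [seq q.1 | q <- s].
have -> : b = r (i b * 1) by rewrite rM // r1 mulr1.
rewrite mulr1 e (klinear_sum lr) (klinear_sum lp) big_seq big1 // => q qs.
by rewrite -iC rM ?pM ?(eqP (s0 q qs)) ?mul0r //; apply: LM; exact: map_f.
Qed.

(* Descent along [x (x) y |-> pi x_(1) (x) x_(2) y], the inverse of which is
   [pi x (x) y |-> x_(1) (x) S x_(2) y]; [Theta] below is this inverse followed by
   the retraction [r] on the first tensor factor. *)
Lemma quotient_coinvariants (H Q : hopf k) (pi : A -> H) (q : A -> Q) (a : A) :
  hopf_map pi -> hopf_map q ->
  (forall x, pi x = 0 -> exists s : seq (A * B),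
     all (fun p => cu B p.2 == 0) s /\ x = \sum_(p <- s) p.1 * i p.2) ->
  teq [seq (pi p.1, q p.2) | p <- cm A a] [:: (1, q a)] ->
  exists b, q a = q (i b).
Proof.
move=> hpi hq kerpi coa; have [[lpi _ pi1] _ _] := hpi; have [[lq qM q1] _ _] := hq.
(* The difference of a_(1) (x) q a_(2) and 1 (x) q a is written with independent second legs;
   coinvariance then forces every first leg x_l into Ker pi. *)
have [w [x [iw wP]]] := tensor_reduce ([seq (p.1, q p.2) | p <- cm A a] ++ [:: (-1, q a)]).
have wE (W : lmodType k) (f : A -> Q -> W) : bilin f ->
    sw a (fun x y => f x (q y)) - f 1 (q a) = \sum_(l < size w) f (x l) w`_l.
  move=> bf; rewrite -wP // big_cat big_map big_seq1 /=.
  by rewrite (klinearN (bilin_l bf _)).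
have pix l : (l < size w)%N -> pi (x l) = 0.
  move=> lw; apply: functional_separates => u lu.
  have [g [lg _ gw]] := dual_functional (subspace_eq0 Q) iw lw.
  have := wE _ _ (bilin_functionals lu lg lpi (@klinear_id _ Q)).
  rewrite (bigD1 (Ordinal lw)) //= gw // eqxx mulr1 big1 ?addr0 => [<-|l' ll].
    by have := coa u g lu lg; rewrite big_map big_seq1 /= pi1 /sw => ->; rewrite subrr.
  by rewrite gw //; move: ll; rewrite -val_eqE /= => /negbTE ->; rewrite mulr0.
have [S SP] : {S : nat -> seq (A * B) & forall l, (l < size w)%N ->
    all (fun p => cu B p.2 == 0) (S l) /\ x l = \sum_(p <- S l) p.1 * i p.2}.
  apply: (@choice _ _ (fun l s => (l < size w)%N ->
    all (fun p => cu B p.2 == 0) s /\ x l = \sum_(p <- s) p.1 * i p.2)) => l.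
  by have [/pix/kerpi [s sP]|_] := boolP (l < size w)%N; [exists s | exists [::]].
have [M [r [[_ _ MC] LM lr r1 rM]]] :=
  hopf_retraction (flatten [seq [seq p.1 | p <- S l] | l <- iota 0 (size w)]).
pose Theta (z : A) (y : Q) := sw z (fun z1 z2 => q (i (r z1) * ap A z2)) * y.
have bT : bilin Theta by rewrite /Theta; klin.
(* On A B^+ a coefficient b enters [Theta] as b_(1) S(b_(2)), which is its counit 0. *)
have T0 l y : (l < size w)%N -> Theta (x l) y = 0.
  move=> lw; have [/allP S0 ->] := SP l lw; rewrite (klinear_sum (bilin_l bT y)).
  rewrite big_seq big1 // => p pS; rewrite /Theta -iC.
  have /MC [t tE tM] : M p.1.
    apply: LM; apply/flattenP; exists [seq p.1 | p <- S l]; last exact: map_f.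
    by apply: map_f; rewrite mem_iota.
  rewrite sw_mul; last by klin.
  rewrite (sw_map _ hi); last by klin.
  under eq_sw => b1 b2 do (rewrite (sw_teq tE); last by klin).
  rewrite sw_sum big_seq big1 ?mul0r // => u /tM Mu.
  transitivity (sw p.2 (fun b1 b2 => q (i (b1 * ap B b2) * (i (r u.1) * ap A u.2)))).
    apply: eq_sw => b1 b2.
    rewrite rM // apM (ap_hopf_map _ hi) !iM -!mulrA; congr (q (_ * _)).
    by rewrite [RHS]iC -mulrA.
  rewrite (sw_apr _ (f := fun z => q (i z * (i (r u.1) * ap A u.2)))); last by klin.
  by rewrite (eqP (S0 p pS)) scale0r.
(* Applied to the difference, [Theta] compares q(i r(a_(1)) S(a_(2)) a_(3)) = q(i r(a)) with q a. *)
exists (r a).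
have := wE _ _ bT; rewrite big1 => [|l _]; last exact: T0.
move/eqP; rewrite subr_eq0 => /eqP; rewrite {2}/Theta sw_one; last by klin.
rewrite r1 i1 ap1 mulr1 q1 mul1r => <-.
rewrite /Theta; under eq_sw => u v.
  rewrite (sw_out _ _ (klinear_mull _ (@klinear_id _ _))).
  under eq_sw => z1 z2 do rewrite -qM -mulrA.
  over.
rewrite (swA a (f := fun z1 z2 v => q (i (r z1) * (ap A z2 * v)))); last by klin.
by rewrite (sw_apl_tail a (f := fun z1 z => q (i (r z1) * z))) ?mulr1 //; klin.
Qed.

End Descent.

(** * Isomorphisms from twisting data *)

Lemma cu_ap (k : fieldType) (A : hopf k) (a : A) : cu A (ap A a) = cu A a.
Proof.
have lcu := @cu_lin_fun k A; have := sw_apl a (W := k^o) (f := cu A) lcu.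
rewrite (cu_one (hopfP A)) [_ *: _]mulr1 => <-.
have lS : klinear (fun x => cu A (ap A x) : k^o).
  by apply: (klinear_comp (W := k^o)) => //; exact: ap_klinear.
rewrite -[LHS](sw_counitr a lS); apply: (eq_sw (W := k^o)) => x y.
by rewrite (cu_mul (hopfP A)) [_ *: _]mulrC.
Qed.

Lemma sum_cm3 (k : fieldType) (A : hopf k) (W : lmodType k) (a : A)
    (f : A -> A -> A -> A -> W) :
  \sum_(x <- cm3 a) f x.1.1.1 x.1.1.2 x.1.2 x.2 =
  sw a (fun a1 b => sw b (fun a2 b => sw b (fun a3 a4 => f a1 a2 a3 a4))).
Proof.
rewrite /cm3 big_flatten big_map; apply: eq_bigr => p _.
rewrite big_flatten big_map; apply: eq_bigr => q _.
by rewrite big_map.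
Qed.

Section TwistedMap.
Variables (k : fieldType) (A K Q : hopf k) (F : A -> Q) (j : K -> Q) (u : A -> K).
Hypotheses (hF : hopf_map F) (hj : hopf_map j) (au : alg_map u).
Hypothesis jC : forall x y, j x * y = y * j x.
Hypothesis uD : forall a, teq [seq (p.1, j p.2) | p <- cm K (u a)]
  [seq (u x.1.1.2, F (ap A x.1.1.1 * x.1.2) * j (u x.2)) | x <- cm3 a].

Let lF := hopf_klinear hF.
Let lj := hopf_klinear hj.
Let lu := alg_klinear au.
Let FM x y : F (x * y) = F x * F y. Proof. by case: hF => -[]. Qed.

Lemma twist_sw (W : lmodType k) (f : K -> Q -> W) (a : A) : bilin f ->
  sw (u a) (fun s t => f s (j t)) = sw a (fun a1 b => sw b (fun a2 b => sw b (fun a3 a4 =>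
    f (u a2) (F (ap A a1 * a3) * j (u a4))))).
Proof.
move=> bf; have := teq_bilin (uD a) bf; rewrite !big_map.
by rewrite (sum_cm3 a (fun a1 a2 a3 a4 => f (u a2) (F (ap A a1 * a3) * j (u a4)))).
Qed.

(* [cu \o u] is convolution idempotent by the comultiplication formula for [u], and
   convolution invertible because it is an algebra map. *)
Lemma twist_counit (a : A) : cu K (u a) = cu A a.
Proof.
have [_ uM u1] := au; have [_ _ Fe] := hF; have [_ _ je] := hj.
pose e a : K := (cu K (u a))%:A.
have le : klinear e by rewrite /e; klin.
have ae : alg_map e.
  split=> [//|x y|]; rewrite /e; last by rewrite u1 (cu_one (hopfP K)) scale1r.
  by rewrite uM (cu_mul (hopfP K)) mulr_algl scalerA.
have lS := @ap_klinear k A.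
have leS : klinear (e \o ap A) by apply: klinear_comp.
have ee : conv e e =1 e.
  move=> b.
  have := twist_sw b (f := fun s t => (cu K s * cu Q t)%:A : K).
  under eq_sw => s t do rewrite je -scalerA.
  rewrite (sw_counitl _ (f := fun t => (cu K t)%:A : K)); last by klin.
  rewrite -/(e b) => ->; last by klin.
  under eq_sw => a1 c.
    under eq_sw => a2 d.
      under eq_sw => a3 a4.
        have -> : (cu K (u a2) * cu Q (F (ap A a1 * a3) * j (u a4)))%:A
            = cu A a1 *: (cu A a3 *: (e a2 * e a4)) :> K.
          rewrite (cu_mul (hopfP Q)) Fe je (cu_mul (hopfP A)) cu_ap /e mulr_algl !scalerA.
          by congr (_ *: _); rewrite mulrC -!mulrA [_ * cu K (u a2)]mulrC.
        over.
      rewrite -(sw_out _ _ (klinear_scaler _ (@klinear_id _ _))).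
      rewrite (sw_counitl d (f := fun a4 => e a2 * e a4)); last by klin.
      over.
    rewrite -(sw_out _ _ (klinear_scaler _ (@klinear_id _ _))); over.
  by rewrite (sw_counitl b (f := conv e e)) //; exact: klinear_conv.
suff : e a = (cu A a)%:A.
  move/(congr1 (cu K)); rewrite /e !(lin_funZ (@cu_lin_fun _ K)).
  by rewrite (cu_one (hopfP K)) !mulr1.
rewrite -(conv_apr ae) -[LHS](conv_unitr le).
rewrite (eq_conv (frefl e) (fsym (conv_apr ae))) convA //.
by apply: eq_conv.
Qed.

(** Multiplicativity uses that [j] is central. For comultiplicativity, the factor F(S a_(3))
    supplied by [uD] cancels against the F(a_(2)) coming from Delta(F(a_(1))). *)
Lemma twist_hopf_map : hopf_map (conv F (j \o u)).
Proof.
have [aF _ Fe] := hF; have [aj _ je] := hj.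
have aju : alg_map (j \o u) := comp_alg_map aj au.
have aC : alg_map (conv F (j \o u)) by apply: conv_alg_map => // x y; rewrite /= jC.
split=> // [a|a]; last first.
  rewrite /conv.
  have := sw_out a (fun x y => F x * j (u y)) (@cu_lin_fun k Q : klinear (V := k^o) _) => ->.
  rewrite -[RHS](sw_counitl a (W := k^o) (@cu_lin_fun k A)).
  apply: (eq_sw (W := k^o)) => x y.
  by rewrite (cu_mul (hopfP Q)) Fe je twist_counit.
move=> f h lf lh; rewrite big_map.
pose beta x y : k^o := f x * h y.
have bb : bilin beta := bilin_functionals lf lh (@klinear_id _ _) (@klinear_id _ _).
rewrite -/(sw (conv F (j \o u) a) beta).
transitivity (sw a (fun x y => beta (conv F (j \o u) x) (conv F (j \o u) y))); last by [].
rewrite {1}/conv (sw_out a _ (sw_klinear bb)) /=.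
transitivity (sw a (fun x1 y => sw y (fun a2 b => sw b (fun a3 a4 =>
    beta (F x1 * j (u a2)) (F a3 * j (u a4)))))).
  under eq_sw => x y.
    rewrite sw_mul //; rewrite (sw_map _ hF); last by klin.
    under eq_sw => x1 x2.
      rewrite (sw_map _ hj); last by klin.
      rewrite (twist_sw y (f := fun s t => beta (F x1 * j s) (F x2 * t))); last by klin.
      over.
    over.
  rewrite (swA a (f := fun x1 x2 y => sw y (fun a1 b => sw b (fun a2 c => sw c (fun a3 a4 =>
    beta (F x1 * j (u a2)) (F x2 * (F (ap A a1 * a3) * j (u a4)))))))); last by klin.
  apply: (eq_sw (W := k^o)) => x1 y.
  under eq_sw => x2 z do under eq_sw => a1 b do under eq_sw => a2 c do
    under eq_sw => a3 a4 do rewrite mulrA -FM mulrA.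
  rewrite (sw_apr_head y (f := fun z b => sw b (fun a2 c => sw c (fun a3 a4 =>
    beta (F x1 * j (u a2)) (F (z * a3) * j (u a4)))))); last by klin.
  by apply: (eq_sw (W := k^o)) => a2 b; apply: (eq_sw (W := k^o)) => a3 a4; rewrite mul1r.
rewrite /conv /=.
transitivity (sw a (fun x y => sw x (fun x1 x2 => sw y (fun y1 y2 =>
    beta (F x1 * j (u x2)) (F y1 * j (u y2)))))).
  by rewrite (swA a (f := fun x1 x2 y => sw y (fun y1 y2 =>
    beta (F x1 * j (u x2)) (F y1 * j (u y2))))) //; klin.
apply: (eq_sw (W := k^o)) => x y; rewrite (sw_out x _ (bilin_l bb _)).
by apply: (eq_sw (W := k^o)) => x1 x2; rewrite (sw_out y _ (bilin_r bb _)).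
Qed.

End TwistedMap.

(** * Pushouts of a central extension *)

Definition pushout (k : fieldType) (B A K Q : hopf k) (i : B -> A) (p : B -> K)
    (q : A -> Q) (j : K -> Q) : Prop :=
  [/\ hopf_map p /\ surjective p, hopf_map q /\ surjective q,
      forall a, q a = 0 <-> exists s : seq (A * B),
        all (fun x => p x.2 == 0) s /\ a = \sum_(x <- s) x.1 * i x.2,
      hopf_map j & forall b, j (p b) = q (i b)].

Section Pushout.
Variables (k : fieldType) (B A H K Q : hopf k) (i : B -> A) (pi : A -> H).
Variables (p : B -> K) (q : A -> Q) (j : K -> Q).
Hypotheses (ex : central_exact i pi) (po : pushout i p q j).

Lemma pushout_central x y : j x * y = y * j x.
Proof.
have [_ _ _ _ iC] := ex; have [[_ sp] [[[_ qM _] _ _] sq] _ _ jp] := po.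
by have [b <-] := sp x; have [a <-] := sq y; rewrite jp -!qM iC.
Qed.

Lemma pushout_base_comm (x y : K) : x * y = y * x.
Proof.
have [[hi _] [ii _] _ _ iC] := ex; have [[[[_ pM _] _ _] sp] _ _ _ _] := po.
have [b <-] := sp x; have [c <-] := sp y.
by rewrite -!pM (central_subalg_comm hi ii iC).
Qed.

Lemma pushout_kernel (R : algType k) (f : A -> R) : alg_map f ->
  (forall b, p b = 0 -> f (i b) = 0) -> forall a, q a = 0 -> f a = 0.
Proof.
have [_ _ kq _ _] := po; move=> [lf fM _] f0 a /kq [s [/allP s0 ->]].
rewrite (klinear_sum lf) big_seq big1 // => x /s0 /eqP x0.
by rewrite fM f0 // mulr0.
Qed.

Lemma pushout_induced : exists2 pi' : Q -> H, hopf_map pi' & forall a, pi' (q a) = pi a.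
Proof.
have [[_ hpi] _ kpi _ _] := ex; have [[[_ _ pe] _] [hq sq] _ _ _] := po.
have [pi' pi'q] : exists h, forall a, h (q a) = pi a.
  apply: (factor_ker (hopf_klinear hq) (hopf_klinear hpi) sq).
  apply: (pushout_kernel (hopf_alg hpi)) => b pb; apply/kpi.
  exists [:: (1, b)]; rewrite big_seq1 mul1r; split=> //=.
  by rewrite -pe pb (klinear0 (V := k^o) (@cu_lin_fun _ _)) eqxx.
by exists pi' => //; apply: hopf_map_factor pi'q.
Qed.

Hypothesis accA : acc_on (@right_ideal k A).

(** Lift x - y to b in B: then i b lies in A J, and contraction to B gives p b = 0. *)
Lemma pushout_inj : injective j.
Proof.
have [[hi _] [ii _] _ _ iC] := ex; have [[hp sp] _ kq hj jp] := po.
move=> x y exy; apply/eqP; rewrite -subr_eq0; have [b eb] := sp (x - y).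
have /kq [s [s0 e]] : q (i b) = 0.
  by rewrite -jp eb (klinearB (hopf_klinear hj)) exy subrr.
by rewrite -eb (extended_ideal_contract hi ii iC accA (hopf_alg hp) s0 e).
Qed.

Lemma pushout_coinvariants (pi' : Q -> H) (y : Q) : hopf_map pi' ->
  (forall a, pi' (q a) = pi a) ->
  teq [seq (pi' x.1, x.2) | x <- cm Q y] [:: (1, y)] -> exists x, j x = y.
Proof.
move=> hpi' pi'q coy.
have [[hi hpi] [ii _] kpi _ iC] := ex; have [_ [hq sq] _ _ jp] := po.
have [a ea] := sq y.
have [||b eb] := quotient_coinvariants hi ii iC accA hpi hq (a := a).
- by move=> x /kpi.
- move=> u v lu lv; rewrite big_map -ea in coy *.
  have bf := bilin_functionals lu lv (hopf_klinear hpi') (@klinear_id _ Q).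
  have := coy u v lu lv; rewrite big_map => <-.
  have [_ qD _] := hq; rewrite (teq_bilin (qD a) bf) big_map.
  by apply: eq_bigr => x _; rewrite pi'q.
by exists (p b); rewrite jp -eb.
Qed.

End Pushout.

(* [i B] is the algebra of coinvariants of [pi]. *)
Lemma lift_restrict (k : fieldType) (B A H : hopf k) (i : B -> A) (pi : A -> H)
    (F : A -> A) (f : H -> H) : central_exact i pi -> hopf_map F -> hopf_map f ->
  (forall a, pi (F a) = f (pi a)) -> forall b, exists c, F (i b) = i c.
Proof.
move=> [[hi hpi] _ _ coi _] hF hf piF b; apply/coi => u v lu lv.
rewrite big_map big_seq1 /=.
have bf := bilin_functionals lu lv (hopf_klinear hpi) (@klinear_id _ A).
have bf' := bilin_functionals lu lv (hopf_klinear hf) (hopf_klinear hF).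
rewrite -/(sw (W := k^o) (F (i b)) (fun x y => u (pi x) * v y)) (sw_map _ hF bf).
have /coi coib : exists c, i b = i c by exists b.
have := teq_bilin coib bf'; rewrite big_map big_seq1 /=.
have [[_ _ ->] _ _] := hf => <-.
by apply: eq_bigr => x _; rewrite /= piF.
Qed.

(** * From twisting data to an isomorphism of pushouts *)

Section DataToIso.
Variables (k : fieldType) (B A H K1 K2 A1 A2 : hopf k).
Variables (i : B -> A) (pi : A -> H).
Variables (p1 : B -> K1) (q1 : A -> A1) (j1 : K1 -> A1).
Variables (p2 : B -> K2) (q2 : A -> A2) (j2 : K2 -> A2).
Hypothesis ex : central_exact i pi.
Hypotheses (po1 : pushout i p1 q1 j1) (po2 : pushout i p2 q2 j2).
Variables (w : K1 -> K2) (g : B -> B) (F : A -> A) (f : H -> H) (u : A -> K2).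
Hypotheses (isow : hopf_iso w) (autF : hopf_auto F) (autf : hopf_auto f).
Hypotheses (Fi : forall b, F (i b) = i (g b)) (piF : forall a, pi (F a) = f (pi a)).
Hypothesis au : alg_map u.
Hypothesis wu : forall b, w (p1 b) = \sum_(x <- cm B b) p2 (g x.1) * u (i x.2).
Hypothesis uD : forall a, teq [seq (x.1, j2 x.2) | x <- cm K2 (u a)]
  [seq (u x.1.1.2, q2 (F (ap A x.1.1.1 * x.1.2)) * j2 (u x.2)) | x <- cm3 a].

Lemma data_to_iso : exists Phi : A1 -> A2, hopf_iso Phi.
Proof.
have [[hi hpi] [ii _] _ _ iC] := ex.
have [[hp1 sp1] [hq1 sq1] kq1 hj1 jp1] := po1.
have [[hp2 sp2] [hq2 sq2] kq2 hj2 jp2] := po2.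
have [hw _] := isow; have [hF _] := autF; have [hf _] := autf.
have [w' [[hw' _] wK w'K]] := hopf_iso_inv isow.
have [F' [[hF' _] FK F'K]] := hopf_iso_inv autF.
have [f' [[hf' _] fK f'K]] := hopf_iso_inv autf.
(* The inverse of [F] lifts the inverse of [f], so it also preserves i B; this gives preimages under
   [g]. *)
have gF' b : exists2 c, F' (i b) = i c & g c = b.
  have piF' a : pi (F' a) = f' (pi a) by rewrite -{2}[a]F'K piF fK.
  have [c ec] := lift_restrict ex hF' hf' piF' b.
  by exists c => //; apply: ii; rewrite -Fi -ec F'K.
have hq2F : hopf_map (q2 \o F) := comp_hopf_map hq2 hF.
have j1C := pushout_central ex po1; have j2C := pushout_central ex po2.
have K2C := pushout_base_comm ex po2.
have hPhi0 := twist_hopf_map hq2F hj2 au j2C uD.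
set Phi0 := conv _ _ in hPhi0.
(* By the first equation for [u], the map vanishes on i (Ker p1), which lets it descend to A1. *)
have Phi0i b : Phi0 (i b) = j2 (w (p1 b)).
  have [[lj2 j2M _] _ _] := hj2.
  rewrite /Phi0 /conv (sw_map _ hi); last by rewrite /comp; klin.
  rewrite wu (klinear_sum lj2); apply: eq_bigr => x _ /=.
  by rewrite j2M jp2 Fi.
have [Phi PhiE] : exists Phi, forall a, Phi (q1 a) = Phi0 a.
  apply: (factor_ker (hopf_klinear hq1) (hopf_klinear hPhi0) sq1).
  apply: (pushout_kernel po1 (hopf_alg hPhi0)) => b b0.
  by rewrite Phi0i b0 (klinear0 (hopf_klinear hw)) (klinear0 (hopf_klinear hj2)).
have hPhi : hopf_map Phi := hopf_map_factor hq1 sq1 hPhi0 PhiE.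
have Phij x : Phi (j1 x) = j2 (w x).
  by have [b <-] := sp1 x; rewrite jp1 PhiE Phi0i.
have auS : alg_map (u \o ap A) by apply: ap_alg_map.
pose h := j1 \o w'; have ah : alg_map h := comp_alg_map (hopf_alg hj1) (hopf_alg hw').
have ahu : alg_map (h \o u) := comp_alg_map ah au.
pose X := conv q1 (h \o (u \o ap A)).
have aX : alg_map X.
  apply: conv_alg_map; [exact: hopf_alg | exact: comp_alg_map | ].
  by move=> x y; rewrite /h /= j1C.
have lhuS : klinear (h \o (u \o ap A)) := alg_klinear (comp_alg_map ah auS).
have lhu := alg_klinear ahu; have lq1 := hopf_klinear hq1.
(* Convolving the first equation for [u] with the inverse of u o i solves it for p2 o g; the
   resulting value of [X] on i B makes [Psi] well defined on A2. *)
have Xi b : X (i b) = h (p2 (g b)).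
  have lg : klinear g.
    by move=> c x y; apply: ii; rewrite -Fi !(hopf_klinear hi) (hopf_klinear hF) !Fi.
  have lp2g : klinear (p2 \o g) := klinear_comp (hopf_klinear hp2) lg.
  pose v := u \o i; have av : alg_map v := comp_alg_map au (hopf_alg hi).
  have lv := alg_klinear av.
  have lvS : klinear (v \o ap B) := klinear_comp lv (@ap_klinear _ B).
  have <- : conv (w \o p1) (v \o ap B) b = p2 (g b).
    transitivity (conv (conv (p2 \o g) v) (v \o ap B) b); first exact: eq_conv.
    by rewrite -convA // (eq_conv (frefl _) (conv_apr av)) conv_unitr.
  rewrite [RHS](conv_out _ _ ah) /X [LHS](conv_in hi) //.
  by apply: eq_conv => x; rewrite /h /v /= ?wK ?jp1 // (ap_hopf_map _ hi).
have [Psi PsiE] : exists Psi, forall a, Psi (q2 a) = X (F' a).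
  have aXF' : alg_map (X \o F') := comp_alg_map aX (hopf_alg hF').
  apply: (factor_ker (f := X \o F') (hopf_klinear hq2) (alg_klinear aXF') sq2).
  apply: (pushout_kernel po2 aXF') => b b0 /=.
  have [c -> gc] := gF' b.
  by rewrite Xi gc b0 (klinear0 (alg_klinear ah)).
have aPsi : alg_map Psi.
  exact: alg_map_factor (hopf_alg hq2) sq2 (comp_alg_map aX (hopf_alg hF')) PsiE.
have Psij x : Psi (j2 x) = h x.
  have [b <-] := sp2 x; rewrite jp2 PsiE; have [c -> gc] := gF' b.
  by rewrite Xi gc.
(* In each composite the factors with u and u o S become adjacent in the convolution product and
   cancel. *)
exists Phi; split=> //; exists Psi => y.
  have [a <-] := sq1 y; rewrite PhiE [LHS](conv_out _ _ aPsi).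
  transitivity (conv X (h \o u) a).
    by apply: eq_conv => x /=; rewrite ?PsiE ?FK ?Psij.
  rewrite /X -convA // (eq_conv (frefl q1) (conv_apl ahu)).
  exact: conv_unitr.
have [a <-] := sq2 y; rewrite PsiE -{2}[a]F'K [LHS](conv_out _ _ (hopf_alg hPhi)).
transitivity (conv Phi0 (j2 \o (u \o ap A)) (F' a)).
  by apply: eq_conv => x /=; rewrite ?PhiE // /h /= Phij w'K.
have aju : alg_map (j2 \o u) := comp_alg_map (hopf_alg hj2) au.
have lju := alg_klinear aju; have lq2F := hopf_klinear hq2F.
have ljuS : klinear (j2 \o (u \o ap A)).
  exact: alg_klinear (comp_alg_map (hopf_alg hj2) auS).
rewrite /Phi0 -convA // (eq_conv (frefl _) (conv_apr aju)).
exact: conv_unitr.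
Qed.

End DataToIso.

(** * Twisting data from isomorphisms *)

Section Restriction.
Variables (k : fieldType) (B A H K1 K2 A1 A2 : hopf k).
Variables (i : B -> A) (pi : A -> H).
Variables (p1 : B -> K1) (q1 : A -> A1) (j1 : K1 -> A1).
Variables (p2 : B -> K2) (q2 : A -> A2) (j2 : K2 -> A2).
Hypothesis ex : central_exact i pi.
Hypotheses (po1 : pushout i p1 q1 j1) (po2 : pushout i p2 q2 j2).
Hypothesis accA : acc_on (@right_ideal k A).
Hypothesis HZ : hopf_center_trivial H.
Variables (pi2 : A2 -> H) (Phi : A1 -> A2).
Hypotheses (hpi2 : hopf_map pi2) (pi2q : forall a, pi2 (q2 a) = pi a).
Hypotheses (hPhi : hopf_map Phi) (sPhi : surjective Phi).

(** Every element of [H] comes from A1, in which j1 K1 is central, so the image of K1 is a central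
    Hopf subalgebra of [H]. It is trivial by [HZ], and the counit identifies the scalar. *)
Lemma center_scalar x : pi2 (Phi (j1 x)) = (cu K1 x)%:A.
Proof.
have [_ [_ spi] _ _ _] := ex; have [_ _ _ hj1 _] := po1.
pose h := pi2 \o (Phi \o j1).
have hh : hopf_map h := comp_hopf_map hpi2 (comp_hopf_map hPhi hj1).
have [[lh hM h1] hD he] := hh.
have [||c e] := HZ (S := fun y => exists z, y = h z) _ _ (ex_intro _ x erefl).
- split; first by exists 1.
  + split=> [_ _ [z ->] [t ->]|c _ [z ->]]; first by exists (z + t); rewrite (klinearD lh).
    by exists (c *: z); rewrite (klinearZ lh).
  + by move=> _ _ [z ->] [t ->]; exists (z * t).
  + by move=> _ [z ->]; exists (ap K1 z); rewrite (ap_hopf_map _ hh).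
  + move=> _ [z ->]; exists [seq (h y.1, h y.2) | y <- cm K1 z]; split.
      by move=> _ /mapP[y _ ->]; split; [exists y.1 | exists y.2].
    by move=> u v lu lv; rewrite (hD z u v lu lv).
- have [[_ pi2M _] _ _] := hpi2; have [[_ PhiM _] _ _] := hPhi.
  move=> _ y [z ->]; have [a <-] := spi y; have [t et] := sPhi (q2 a).
  by rewrite -pi2q -et /h /= -!pi2M -!PhiM (pushout_central ex po1).
have := he x; rewrite e (lin_funZ (@cu_lin_fun _ H)) (cu_one (hopfP H)) mulr1.
by move=> <-; rewrite -e.
Qed.

(** By [center_scalar] each Phi(j1 x) is coinvariant under pi2, hence lies in j2 K2; injectivity of
    j2 transports the Hopf map axioms to [w]. *)
Lemma iso_restrict_base : exists2 w : K1 -> K2, hopf_map w & forall x, j2 (w x) = Phi (j1 x).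
Proof.
have [_ _ _ hj1 _] := po1; have [_ _ _ hj2 _] := po2.
have hPj : hopf_map (Phi \o j1) := comp_hopf_map hPhi hj1.
have [[lPj PjM Pj1] PjD Pje] := hPj; have [[lj2 j2M j21] j2D j2e] := hj2.
have j2I : injective j2 := pushout_inj ex po2 accA.
have /choice [w wP] x : exists y, j2 y = Phi (j1 x).
  apply: (pushout_coinvariants ex po2 accA hpi2 pi2q) => u v lu lv.
  rewrite big_map big_seq1 /=.
  have bf := bilin_functionals lu lv (hopf_klinear hpi2) (@klinear_id _ A2).
  rewrite -/(sw (W := k^o) (Phi (j1 x)) (fun y z => u (pi2 y) * v z)).
  have := sw_map x hPj bf; rewrite /= => ->.
  have lf : klinear (fun y => u 1 * v (Phi (j1 y)) : k^o).
    by move=> c y z; have /= -> := lPj c y z; rewrite lv mulrDr mulrCA.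
  rewrite -[RHS](sw_counitl x lf); apply: (eq_sw (W := k^o)) => y z.
  by rewrite center_scalar (lin_funZ lu) -mulrA.
exists w => //; split.
- split=> [c x y|x y|]; apply: j2I; rewrite ?lj2 ?j2M ?j21 ?wP; [exact: lPj|exact: PjM|exact: Pj1].
- move=> x; apply: (teq_sep lj2 j2I lj2 j2I) => u v lu lv.
  have := j2D (w x) u v lu lv; rewrite wP => <-; rewrite (PjD x u v lu lv) !big_map.
  by apply: eq_bigr => y _ /=; rewrite !wP.
- by move=> x; rewrite -j2e wP (Pje x).
Qed.

(** The kernel of [pi] is A B^+, which pi2 o Phi o q1 kills because K1 maps to scalars through its
    counit. *)
Lemma iso_induce_quotient :
  exists2 f : H -> H, hopf_map f & forall a, f (pi a) = pi2 (Phi (q1 a)).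
Proof.
have [[hi hpi] [_ spi] kpi _ _] := ex; have [[[_ _ p1e] _] [hq1 _] _ _ jp1] := po1.
have hPq : hopf_map (pi2 \o (Phi \o q1)) := comp_hopf_map hpi2 (comp_hopf_map hPhi hq1).
have [[lPq PqM _] _ _] := hPq.
have [f fE] : exists f, forall a, f (pi a) = (pi2 \o (Phi \o q1)) a.
  apply: (factor_ker (hopf_klinear hpi) lPq spi) => a /kpi [s [/allP s0 ->]].
  rewrite (klinear_sum lPq) big_seq big1 // => x /s0 /eqP x0.
  by rewrite PqM /= -jp1 center_scalar p1e x0 scale0r mulr0.
by exists f => //; exact: hopf_map_factor hpi spi hPq fE.
Qed.

End Restriction.

(** * The convolution quotient of two Hopf maps *)

Section Theta.
Variables (k : fieldType) (A Q : hopf k) (F P : A -> Q).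
Hypotheses (hF : hopf_map F) (hP : hopf_map P).
Let theta := conv (F \o ap A) P.

Lemma sw_theta (W : lmodType k) (f : Q -> Q -> W) (a : A) : bilin f ->
  sw (theta a) f = sw a (fun a1 b => sw b (fun a2 b => sw b (fun a3 a4 =>
    f (F (ap A a2) * P a3) (F (ap A a1) * P a4)))).
Proof.
move=> bf; rewrite {1}/theta /conv (sw_out a _ (sw_klinear bf)) /=.
rewrite -(swA a (f := fun a1 a2 b => sw b (fun a3 a4 =>
    f (F (ap A a2) * P a3) (F (ap A a1) * P a4)))); last by klin.
apply: eq_sw => x y; rewrite sw_mul // (sw_map _ hF); last by klin.
rewrite sw_ap; last by klin.
by apply: eq_sw => x1 x2; rewrite (sw_map _ hP) //; klin.
Qed.

Lemma conv_theta : conv F theta =1 P.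
Proof.
have lP := hopf_klinear hP; have lF := hopf_klinear hF.
have lFS : klinear (F \o ap A) := klinear_comp lF (@ap_klinear _ A).
move=> a; rewrite /theta convA // (eq_conv (conv_apr (hopf_alg hF)) (frefl P)).
exact: conv_unitl.
Qed.

Lemma klinear_theta : klinear theta.
Proof.
apply: klinear_conv; last exact: hopf_klinear.
exact: (klinear_comp (hopf_klinear hF) (@ap_klinear _ A)).
Qed.

(** As S reverses products, theta(ab) = F(S b_(1)) theta(a) P(b_(2)), and the central element
    theta(a) can be pulled to the front. *)
Lemma theta_mul a b : (forall y, theta a * y = y * theta a) ->
  theta (a * b) = theta a * theta b.
Proof.
move=> aC; have [[lF FM _] _ _] := hF; have [[lP PM _] _ _] := hP.
rewrite {1}/theta /conv sw_mul /comp; last by klin.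
rewrite sw_exchange /theta /conv /comp.
rewrite [RHS](sw_out b _ (klinear_mulr _ (@klinear_id _ _))).
apply: eq_sw => b1 b2; rewrite mulrA -/(theta a).
transitivity (F (ap A b1) * theta a * P b2); last by rewrite aC.
rewrite /theta /conv (sw_out a _ (klinear_mulr _ (@klinear_id _ _))).
rewrite (sw_out a _ (klinear_mull _ (@klinear_id _ _))); apply: eq_sw => a1 a2 /=.
by rewrite apM FM PM !mulrA.
Qed.

End Theta.

Section IsoToData.
Variables (k : fieldType) (B A H K1 K2 A1 A2 : hopf k).
Variables (i : B -> A) (pi : A -> H).
Variables (p1 : B -> K1) (q1 : A -> A1) (j1 : K1 -> A1).
Variables (p2 : B -> K2) (q2 : A -> A2) (j2 : K2 -> A2).
Hypothesis ex : central_exact i pi.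
Hypotheses (po1 : pushout i p1 q1 j1) (po2 : pushout i p2 q2 j2).
Hypothesis accA : acc_on (@right_ideal k A).
Hypothesis HZ : hopf_center_trivial H.

(** Restriction to the base and passage to the quotient are applied to [Phi] and to its inverse,
    giving mutually inverse maps. *)
Lemma iso_induced (Phi : A1 -> A2) (pi2 : A2 -> H) : hopf_iso Phi -> hopf_map pi2 ->
  (forall a, pi2 (q2 a) = pi a) ->
  exists (w : K1 -> K2) (f : H -> H), [/\ hopf_iso w, hopf_auto f,
    forall x, j2 (w x) = Phi (j1 x) & forall a, f (pi a) = pi2 (Phi (q1 a))].
Proof.
move=> isoP hpi2 pi2q; have [hPhi _] := isoP.
have [Phi' [[hPhi' _] PK P'K]] := hopf_iso_inv isoP.
have sP : surjective Phi by move=> y; exists (Phi' y).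
have sP' : surjective Phi' by move=> y; exists (Phi y).
have [pi1 hpi1 pi1q] := pushout_induced ex po1.
have [w hw wP] := iso_restrict_base ex po1 po2 accA HZ hpi2 pi2q hPhi sP.
have [w' hw' w'P] := iso_restrict_base ex po2 po1 accA HZ hpi1 pi1q hPhi' sP'.
have [f hf fP] := iso_induce_quotient ex po1 HZ hpi2 pi2q hPhi sP.
have [f' hf' f'P] := iso_induce_quotient ex po2 HZ hpi1 pi1q hPhi' sP'.
have [_ [_ spi] _ _ _] := ex.
have [_ [_ sq1] _ _ _] := po1; have [_ [_ sq2] _ _ _] := po2.
exists w, f; split=> //; split=> //.
  exists w' => x; [apply: (pushout_inj ex po1 accA) | apply: (pushout_inj ex po2 accA)].
    by rewrite w'P wP PK.
  by rewrite wP w'P P'K.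
exists f' => x; have [a <-] := spi x.
  by rewrite fP; have [b eb] := sq2 (Phi (q1 a)); rewrite -eb pi2q f'P eb PK pi1q.
by rewrite f'P; have [b eb] := sq1 (Phi' (q2 a)); rewrite -eb pi1q fP eb P'K pi2q.
Qed.

Lemma iso_to_data (Phi : A1 -> A2) : hopf_iso Phi ->
  (forall f : H -> H, hopf_auto f ->
     exists F : A -> A, hopf_auto F /\ forall a, pi (F a) = f (pi a)) ->
  exists (w : K1 -> K2) (g : B -> B) (F : A -> A) (wbar : H -> H) (u : A -> K2),
     [/\ hopf_iso w,
         qAut i pi g /\ hopf_auto F /\ hopf_auto wbar /\
           (forall b, F (i b) = i (g b)) /\ (forall a, pi (F a) = wbar (pi a)),
         alg_map u,
         (forall b : B, w (p1 b) = \sum_(p <- cm B b) p2 (g p.1) * u (i p.2))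
       & (forall a : A,
           teq [seq (p.1, j2 p.2) | p <- cm K2 (u a)]
               [seq (u x.1.1.2, q2 (F (ap A x.1.1.1 * x.1.2)) * j2 (u x.2))
                  | x <- cm3 a])].
Proof.
move=> isoP lift; have [hPhi _] := isoP.
have [[hi hpi] [ii spi] _ _ iC] := ex.
have [[hp1 sp1] [hq1 sq1] kq1 hj1 jp1] := po1.
have [[hp2 sp2] [hq2 sq2] kq2 hj2 jp2] := po2.
have [pi2 hpi2 pi2q] := pushout_induced ex po2.
have [w [f [isow autf wP fP]]] := iso_induced isoP hpi2 pi2q.
have [F [autF piF]] := lift f autf; have [hF _] := autF; have [hf _] := autf.
have [g Fi] := choice (lift_restrict ex hF hf piF).
have qg : qAut i pi g by apply: gen_base; exists F, f; split.
have j2I : injective j2 := pushout_inj ex po2 accA.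
have j2C := pushout_central ex po2.
have hQF : hopf_map (q2 \o F) := comp_hopf_map hq2 hF.
have hP : hopf_map (Phi \o q1) := comp_hopf_map hPhi hq1.
pose QF := q2 \o F; pose P := Phi \o q1; pose theta := conv (QF \o ap A) P.
have ltheta : klinear theta := klinear_theta hQF hP.
have [[lj2 j2M j21] j2D _] := hj2; have [[lQF QFM QF1] _ _] := hQF.
have [[lP PM P1] _ _] := hP.
have [[lpi2 pi2M _] _ _] := hpi2; have [[lf fM f1] _ _] := hf; have [[lpi piM pi1] _ _] := hpi.
(* theta(a) is coinvariant: the first leg F(S a_(2)) P(a_(3)) of its comultiplication has image
   f(pi(S a_(2) a_(3))) in [H], which collapses to a counit. *)
have /choice [u uP] a : exists y, j2 y = theta a.
  apply: (pushout_coinvariants ex po2 accA hpi2 pi2q) => x y lx ly.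
  rewrite big_map big_seq1 /=.
  have bf := bilin_functionals lx ly lpi2 (@klinear_id _ A2).
  rewrite -/(sw (W := k^o) (theta a) (fun z t => x (pi2 z) * y t)) (sw_theta hQF hP _ bf).
  pose G a1 z t : k^o := x (f (pi z)) * y (QF (ap A a1) * P t).
  have bG a1 : bilin (G a1).
    apply: (bilin_functionals lx ly (klinear_comp lf lpi)).
    by apply: klinear_mulr.
  transitivity (sw a (fun a1 b => x 1 * y (QF (ap A a1) * P b) : k^o)).
    apply: (eq_sw (W := k^o)) => a1 b.
    have := sw_apl_head b (bG a1); rewrite /G pi1 f1 => <-.
    apply: (eq_sw (W := k^o)) => a2 c; apply: (eq_sw (W := k^o)) => a3 a4.
    by rewrite pi2M /= pi2q piF -fP -fM piM.
  have lxy : klinear (fun z => x 1 * y z : k^o).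
    by move=> c z t; rewrite ly mulrDr mulrCA.
  by rewrite /theta /conv (sw_out a _ lxy).
have thC a y : theta a * y = y * theta a by rewrite -uP j2C.
have au : alg_map u.
  split=> [c x y|x y|]; apply: j2I; rewrite ?lj2 ?j2M ?j21 ?uP ?ltheta //.
    exact: theta_mul.
  rewrite /theta /conv sw_one; last by rewrite /comp; klin.
  by have /= PP := P1; have /= QQ := QF1; rewrite /= ap1 /P /QF /= PP QQ mulr1.
have FthP : conv QF theta =1 P := conv_theta hQF hP.
exists w, g, F, f, u; split=> //.
- move=> b; apply: j2I; rewrite wP jp1 (klinear_sum lj2).
  transitivity (P (i b)) => //; rewrite -FthP /conv (sw_map _ hi); last by klin.
  by apply: eq_bigr => x _; rewrite j2M uP jp2 -Fi.
(* Extending the functional [x] along j2 moves the identity into A2 (x) A2, where theta replaces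
   [u]. *)
move=> a x y lx ly; have [x' lx' xE] := klinear_extend (W := k^o) lj2 j2I lx.
rewrite !big_map /=.
transitivity (sw (theta a) (fun z t => x' z * y t : k^o)).
  rewrite -uP /sw; have := j2D (u a) x' y lx' ly; rewrite big_map => ->.
  by apply: eq_bigr => p _ /=; rewrite xE.
have bf := bilin_functionals lx' ly (@klinear_id _ A2) (@klinear_id _ A2).
rewrite (sw_theta hQF hP _ bf).
rewrite (sum_cm3 a (W := k^o) (fun a1 a2 a3 a4 =>
  x (u a2) * y (q2 (F (ap A a1 * a3)) * j2 (u a4)))).
apply: (eq_sw (W := k^o)) => a1 b.
(* Regroup the first leg into a single theta, then rewrite the remaining [P] as the convolution of
   [QF] and theta. *)
transitivity (sw b (fun a2 c => x' (theta a2) * y (QF (ap A a1) * P c) : k^o)).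
  have tG : trilin (fun a2 a3 c => x' (QF (ap A a2) * P a3) * y (QF (ap A a1) * P c) : k^o).
    by split=> z t; match goal with |- klinear ?h => change (lin_fun h) end; klin.
  have := swA b tG => <-; apply: (eq_sw (W := k^o)) => a2 c.
  have lG : klinear (fun z => x' z * y (QF (ap A a1) * P c) : k^o).
    by match goal with |- klinear ?h => change (lin_fun h) end; klin.
  by rewrite {1}/theta /conv (sw_out a2 _ lG).
apply: (eq_sw (W := k^o)) => a2 c.
have lG : klinear (fun z => x' (theta a2) * y (QF (ap A a1) * z) : k^o).
  by match goal with |- klinear ?h => change (lin_fun h) end; klin.
rewrite -FthP /conv (sw_out c _ lG); apply: (eq_sw (W := k^o)) => a3 a4.
by rewrite -uP xE -uP mulrA -QFM.
Qed.


End IsoToData.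

Theorem theorem2p15 (k : fieldType) (B A H K1 K2 A1 A2 : hopf k)
  (i : B -> A) (pi : A -> H)
  (p1 : B -> K1) (p2 : B -> K2)
  (q1 : A -> A1) (q2 : A -> A2)
  (j1 : K1 -> A1) (j2 : K2 -> A2) :
  central_exact i pi ->
  noetherian A ->
  (* p_i surjective Hopf maps, J_i = Ker p_i *)
  hopf_map p1 -> surjective p1 ->
  hopf_map p2 -> surjective p2 ->
  (* A_i = A / A J_i with quotient map q_i *)
  hopf_map q1 -> surjective q1 ->
  (forall a : A, q1 a = 0 <-> exists s : seq (A * B),
      all (fun p => p1 p.2 == 0) s /\ a = \sum_(p <- s) p.1 * i p.2) ->
  hopf_map q2 -> surjective q2 ->
  (forall a : A, q2 a = 0 <-> exists s : seq (A * B),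
      all (fun p => p2 p.2 == 0) s /\ a = \sum_(p <- s) p.1 * i p.2) ->
  (* j_i : K_i -> A_i the induced maps *)
  hopf_map j1 -> (forall b, j1 (p1 b) = q1 (i b)) ->
  hopf_map j2 -> (forall b, j2 (p2 b) = q2 (i b)) ->
  (* (L) *)
  (forall f : H -> H, hopf_auto f ->
     exists F : A -> A, hopf_auto F /\ forall a, pi (F a) = f (pi a)) ->
  (* (Z) *)
  hopf_center_trivial H ->
  (exists Phi : A1 -> A2, hopf_iso Phi) <->
  (exists (w : K1 -> K2) (g : B -> B) (F : A -> A) (wbar : H -> H) (u : A -> K2),
     [/\ hopf_iso w,
         qAut i pi g /\ hopf_auto F /\ hopf_auto wbar /\
           (forall b, F (i b) = i (g b)) /\ (forall a, pi (F a) = wbar (pi a)),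
         alg_map u,
         (forall b : B, w (p1 b) = \sum_(p <- cm B b) p2 (g p.1) * u (i p.2))
       & (forall a : A,
           teq [seq (p.1, j2 p.2) | p <- cm K2 (u a)]
               [seq (u x.1.1.2, q2 (F (ap A x.1.1.1 * x.1.2)) * j2 (u x.2))
                  | x <- cm3 a])]).
Proof.
move=> ex [_ accA] hp1 sp1 hp2 sp2 hq1 sq1 kq1 hq2 sq2 kq2 hj1 jp1 hj2 jp2 lift HZ.
have po1 : pushout i p1 q1 j1 by split.
have po2 : pushout i p2 q2 j2 by split.
split=> [[Phi isoP]|]; first exact: (iso_to_data ex po1 po2 accA HZ isoP lift).
move=> [w [g [F [f [u [isow [_ [autF [autf [Fi piF]]]] au wu uD]]]]]].
exact: (data_to_iso ex po1 po2 isow autF autf Fi piF au wu uD).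
Qed.
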